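(* For $\lambda=2\cos(z/2)$ and $z\in\mathbb{C}_+:=\{z\in\mathbb{C}:\operatorname{Im}z>0\}$, the sequences $$f_n^+(z)=\alpha_n^+e^{inz}\Bigl(1+\sum_{m=1}^{\infty}K_{n,m}^+e^{imz/2}\Bigr),\qquad f_n^-(z)=\alpha_n^-e^{-inz}\Bigl(1+\sum_{m=-\infty}^{-1}K_{n,m}^-e^{-imz/2}\Bigr),\qquad n\in\mathbb{Z},$$ solve the difference equation $$\Delta(a_{n-1}\Delta y_{n-1})+(q_n+2\lambda p_n+\lambda^2)y_n=0,\qquad n\in\mathbb{Z}.$$ The coefficients $\alpha_n^\pm$ and the kernels $K_{n,m}^\pm$ are uniquely expressed in terms of $(a_n)_{n\in\mathbb{Z}}$, $(p_n)_{n\in\mathbb{Z}}$ and $(h_n)_{n\in\mathbb{Z}}$, where $h_n=2-a_n-a_{n-1}+q_n$, as follows: $$\alpha_n^+=\Bigl(\prod_{r=n}^{\infty}(-a_r)\Bigr)^{-1},\quad K_{n,1}^+=2\sum_{r=n+1}^{\infty}p_r,\quad K_{n,2}^+=\sum_{r=n+1}^\infty\bigl(h_r+2p_rK_{r,1}^+\bigr),$$ $$K_{n,3}^+=\sum_{r=n+1}^\infty\bigl(h_rK_{r,1}^++2p_r(K_{r,2}^++1)\bigr),$$ $$K_{n,4}^+=\sum_{r=n+1}^\infty\bigl((1-a_r^2)+h_rK_{r,2}^++2p_r(K_{r,3}^++K_{r,1}^+)\bigr),$$ $$K_{n,m+4}^+=K_{n,m}^++\sum_{r=n+1}^\infty\bigl((1-a_r^2)K_{r+1,m}^++h_rK_{r,m+2}^++2p_r(K_{r,m+1}^++K_{r,m+3}^+)\bigr)$$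 for $m=1,2,\dots$ and $n\in\mathbb{Z}$, and $$\alpha_n^-=\Bigl(\prod_{r=-\infty}^{n-1}(-a_r)\Bigr)^{-1},\quad K_{n,-1}^-=2\sum_{r=-\infty}^{n-1}p_r,\quad K_{n,-2}^-=\sum_{r=-\infty}^{n-1}\bigl(h_r+2p_rK_{r,-1}^-\bigr),$$ $$K_{n,-3}^-=\sum_{r=-\infty}^{n-1}\bigl(h_rK_{r,-1}^-+2p_r(K_{r,-2}^-+1)\bigr),$$ $$K_{n,-4}^-=\sum_{r=-\infty}^{n-1}\bigl((1-a_{r-1}^2)+h_rK_{r,-2}^-+2p_r(K_{r,-3}^-+K_{r,-1}^-)\bigr),$$ $$K_{n,m-4}^-=K_{n,m}^-+\sum_{r=-\infty}^{n-1}\bigl((1-a_{r-1}^2)K_{r-1,m}^-+h_rK_{r,m-2}^-+2p_r(K_{r,m-1}^-+K_{r,m-3}^-)\bigr)$$ for $m=-1,-2,\dots$ and $n\in\mathbb{Z}$.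
   Context: Standing assumptions: $(a_n)_{n\in\mathbb{Z}}$, $(p_n)_{n\in\mathbb{Z}}$, $(q_n)_{n\in\mathbb{Z}}$ are complex sequences with $a_n\neq0$ for all $n\in\mathbb{Z}$ and $\sum_{n\in\mathbb{Z}}|n|\,(|1-a_n|+|p_n|+|q_n|)<\infty$. $\Delta$ is the forward difference operator, $\Delta y_n=y_{n+1}-y_n$.
   Formalization: In the recursions for K_{n,m+4}^+ and K_{n,m-4}^- the leading terms K_{n,m}^± are corrected to K_{n+1,m}^+ and K_{n-1,m}^-; the products of (-a_r), which do not converge as a_r→1, are taken as limits along even cut-offs (r<2N, r≥-2N). *)

(* Defs.v *)
(* Stdlib reals with Coquelicot. *)
From Stdlib Require Import Reals ZArith.
From Coquelicot Require Import Coquelicot.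

Open Scope C_scope.

Definition Cexp (z : C) : C :=
  (exp (Re z) * cos (Im z), exp (Re z) * sin (Im z))%R.

Definition Ccos (z : C) : C := (Cexp (Ci * z) + Cexp (- (Ci * z))) / 2.

Definition ZtoC (n : Z) : C := RtoC (IZR n).

(* A sum over Z of nonnegative terms is finite iff both one-sided series are. *)
Definition summableZ (u : Z -> R) : Prop :=
  ex_series (fun k : nat => u (Z.of_nat k)) /\
  ex_series (fun k : nat => u (- Z.of_nat (S k))%Z).

(* s = sum_{r = n}^{+oo} u_r *)
Definition sum_from (u : Z -> C) (n : Z) (s : C) : Prop :=
  is_series (fun k : nat => u (n + Z.of_nat k)%Z) s.

(* s = sum_{r = -oo}^{n} u_r *)
Definition sum_upto (u : Z -> C) (n : Z) (s : C) : Prop :=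
  is_series (fun k : nat => u (n - Z.of_nat k)%Z) s.

(* u_n u_{n+1} ... u_{n+k-1} *)
Fixpoint prodZ (u : Z -> C) (n : Z) (k : nat) : C :=
  match k with
  | O => 1
  | S j => prodZ u n j * u (n + Z.of_nat j)%Z
  end.

(* Infinite products prod_{r = n}^{+oo} u_r and prod_{r = -oo}^{n} u_r, with
   a nonzero value.  They are used for u_r = - a_r with a_r -> 1; such a
   product has no limit along all cut-offs, because its partial products
   asymptotically alternate in sign.  The limit is therefore taken along the
   cut-offs r < 2N, respectively r >= -2N, the same for every n, so that
   prod_{r >= n} (- a_r) = (-1)^n prod_{r >= n} a_r.  Odd cut-offs would only
   multiply the value by -1 for all n simultaneously. *)
Definition is_prod_from (u : Z -> C) (n : Z) (P : C) : Prop :=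
  P <> 0 /\
  filterlim
    (fun N : nat => prodZ u n (Z.to_nat (2 * Z.of_nat N - n)))
    eventually (locally P).

Definition is_prod_upto (u : Z -> C) (n : Z) (P : C) : Prop :=
  P <> 0 /\
  filterlim
    (fun N : nat =>
       prodZ u (- (2 * Z.of_nat N)) (Z.to_nat (n + 1 + 2 * Z.of_nat N)))
    eventually (locally P).

Definition fdiff (y : Z -> C) (n : Z) : C := y (n + 1)%Z - y n.

Definition solves (a p q : Z -> C) (lambda : C) (y : Z -> C) : Prop :=
  forall n : Z,
    fdiff (fun k : Z => a (k - 1)%Z * fdiff y (k - 1)%Z) n
    + (q n + 2 * lambda * p n + lambda ^ 2) * y n = 0.

Definition hseq (a q : Z -> C) (n : Z) : C := 2 - a n - a (n - 1)%Z + q n.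

(* f_n = alpha_n e^{inz} (1 + sum_{m >= 1} K_{n,m} e^{imz/2}) for all n,
   including the convergence of the series. *)
Definition jost_plus (alpha : Z -> C) (K : Z -> Z -> C) (z : C)
    (f : Z -> C) : Prop :=
  forall n : Z, exists s : C,
    sum_from (fun m : Z => K n m * Cexp (Ci * ZtoC m * z / 2)) 1 s /\
    f n = alpha n * Cexp (Ci * ZtoC n * z) * (1 + s).

(* f_n = alpha_n e^{-inz} (1 + sum_{m <= -1} K_{n,m} e^{-imz/2}) for all n. *)
Definition jost_minus (alpha : Z -> C) (K : Z -> Z -> C) (z : C)
    (f : Z -> C) : Prop :=
  forall n : Z, exists s : C,
    sum_upto (fun m : Z => K n m * Cexp (- (Ci * ZtoC m * z / 2))) (-1) s /\
    f n = alpha n * Cexp (- (Ci * ZtoC n * z)) * (1 + s).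

(* Only the entries K n m with m >= 1 are meaningful.  In the recursion for
   K_{n,m+4}, the term outside the sum is K_{n+1,m}: comparing coefficients in
   the difference equation gives
     K_{r-1,m+4} - K_{r,m+4} = (K_{r,m} - K_{r+1,m}) + (1 - a_r^2) K_{r+1,m}
       + h_r K_{r,m+2} + 2 p_r (K_{r,m+1} + K_{r,m+3}),
   and the first difference telescopes over r >= n+1 to K_{n+1,m}. *)
Definition kernel_plus (a p h : Z -> C) (alpha : Z -> C)
    (K : Z -> Z -> C) : Prop :=
  forall n : Z,
    (exists P : C,
       is_prod_from (fun r => - a r) n P /\ alpha n = / P) /\
    (exists s : C, sum_from p (n + 1) s /\ K n 1%Z = 2 * s) /\
    sum_from (fun r => h r + 2 * p r * K r 1%Z) (n + 1) (K n 2%Z) /\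
    sum_from (fun r => h r * K r 1%Z + 2 * p r * (K r 2%Z + 1))
      (n + 1) (K n 3%Z) /\
    sum_from (fun r => (1 - a r ^ 2) + h r * K r 2%Z
                       + 2 * p r * (K r 3%Z + K r 1%Z))
      (n + 1) (K n 4%Z) /\
    (forall m : Z, (1 <= m)%Z -> exists s : C,
       sum_from (fun r => (1 - a r ^ 2) * K (r + 1)%Z m
                          + h r * K r (m + 2)%Z
                          + 2 * p r * (K r (m + 1)%Z + K r (m + 3)%Z))
         (n + 1) s /\
       K n (m + 4)%Z = K (n + 1)%Z m + s).

(* Only the entries K n m with m <= -1 are meaningful.  The term outside the
   sum in the recursion is K_{n-1,m}, the telescoped sum over r <= n-1 of
   K_{r,m} - K_{r-1,m}. *)
Definition kernel_minus (a p h : Z -> C) (alpha : Z -> C)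
    (K : Z -> Z -> C) : Prop :=
  forall n : Z,
    (exists P : C,
       is_prod_upto (fun r => - a r) (n - 1) P /\ alpha n = / P) /\
    (exists s : C, sum_upto p (n - 1) s /\ K n (-1)%Z = 2 * s) /\
    sum_upto (fun r => h r + 2 * p r * K r (-1)%Z) (n - 1) (K n (-2)%Z) /\
    sum_upto (fun r => h r * K r (-1)%Z + 2 * p r * (K r (-2)%Z + 1))
      (n - 1) (K n (-3)%Z) /\
    sum_upto (fun r => (1 - a (r - 1)%Z ^ 2) + h r * K r (-2)%Z
                       + 2 * p r * (K r (-3)%Z + K r (-1)%Z))
      (n - 1) (K n (-4)%Z) /\
    (forall m : Z, (m <= -1)%Z -> exists s : C,
       sum_upto (fun r => (1 - a (r - 1)%Z ^ 2) * K (r - 1)%Z m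
                          + h r * K r (m - 2)%Z
                          + 2 * p r * (K r (m - 1)%Z + K r (m - 3)%Z))
         (n - 1) s /\
       K n (m - 4)%Z = K (n - 1)%Z m + s).

Definition same_plus (alpha alpha' : Z -> C) (K K' : Z -> Z -> C) : Prop :=
  forall n : Z, alpha' n = alpha n /\
    forall m : Z, (1 <= m)%Z -> K' n m = K n m.

Definition same_minus (alpha alpha' : Z -> C) (K K' : Z -> Z -> C) : Prop :=
  forall n : Z, alpha' n = alpha n /\
    forall m : Z, (m <= -1)%Z -> K' n m = K n m.

(* Main.v *)
(* Put w = e^{iz/2}, so that lambda = w + 1/w and lambda^2 - 2 = w^2 + w^{-2}.
   With alpha_{n+1} = - a_n alpha_n, the ansatz f_n = alpha_n w^{2n} g_n turns
   the difference equation into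
     g_{n-1} = g_n + w^4 (g_n - g_{n+1}) + (1 - a_n^2) w^4 g_{n+1}
               + h_n w^2 g_n + 2 p_n (w^3 + w) g_n,
   whose coefficients in w are the differences of the recursions for K_{n,m}.
   For every rho > 1 one has |K_{n,m}| <= rho^{m+3} once n is so large that the
   tail of |1 - a_r^2| + |h_r| + 4 |p_r| is at most rho - 1; the differenced
   recursion carries an O(rho^m) bound from n to n - 1, so the power series g_n
   converges on the whole unit disc.  Its coefficients are determined by its
   values at real w in (0, 1).  The statement at -oo is the one at +oo for
   a_{-n-1}, p_{-n}, q_{-n}. *)
Require Import Defs.
From Stdlib Require Import Reals ZArith Lra Lia.
From Coquelicot Require Import Coquelicot.

Local Open Scope C_scope.

(** * Series of complex numbers *)

Lemma is_series_C_unique (u : nat -> C) (s t : C) :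
  is_series u s -> is_series u t -> s = t.
Proof. exact (filterlim_locally_unique _ s t). Qed.

Lemma ex_series_Cmod_le (u : nat -> C) (b : nat -> R) :
  (forall k, (Cmod (u k) <= b k)%R) -> ex_series b -> ex_series u.
Proof. exact (@ex_series_le C_AbsRing C_CompleteNormedModule u b). Qed.

Lemma is_series_Cmod_le (u : nat -> C) (b : nat -> R) (s : C) (t : R) :
  (forall k, (Cmod (u k) <= b k)%R) -> is_series u s -> is_series b t ->
  (Cmod s <= t)%R.
Proof.
  intros H Hu Hb.
  assert (Hn : is_lim_seq (fun n => Cmod (sum_n u n)) (Cmod s)).
  { exact (filterlim_comp _ _ _ _ _ _ _ _ Hu
             (@filterlim_norm C_AbsRing C_NormedModule s)). }
  refine (is_lim_seq_le _ _ (Cmod s) t _ Hn Hb).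
  intro n. unfold sum_n.
  eapply Rle_trans;
    [exact (@norm_sum_n_m C_AbsRing C_NormedModule u 0 n)|].
  apply sum_n_m_le. exact H.
Qed.

(** A total sum, with no convergence proof as argument, so that [kern] can be defined by recursion
    before its sums are known to converge. *)
Definition Csum (u : nat -> C) : C :=
  @iota C_CompleteNormedModule (is_series u).

Lemma Csum_correct (u : nat -> C) : ex_series u -> is_series u (Csum u).
Proof.
  intros [s Hs].
  apply (@iota_correct C_AbsRing C_CompleteNormedModule (is_series u)).
  exists s. split; [exact Hs|]. intros t Ht. exact (is_series_C_unique _ _ _ Hs Ht).
Qed.

(** * Summability and tails on right half-lines *)

Definition tail_summable (c : Z -> R) : Prop :=
  forall n, ex_series (fun k => c (n + Z.of_nat k)%Z).

Definition tail (c : Z -> R) (n : Z) : R :=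
  Series (fun k => c (n + Z.of_nat k)%Z).

Lemma tail_summable_from (c : Z -> R) (n0 : Z) :
  ex_series (fun k => c (n0 + Z.of_nat k)%Z) -> tail_summable c.
Proof.
  intros H n. destruct (Z.le_gt_cases n0 n) as [L|L].
  - apply (proj1 (ex_series_incr_n _ (Z.to_nat (n - n0)))) in H.
    revert H. apply ex_series_ext. intro k. f_equal. lia.
  - apply (ex_series_incr_n _ (Z.to_nat (n0 - n))).
    revert H. apply ex_series_ext. intro k. f_equal. lia.
Qed.

Lemma tail_summable_shift (c : Z -> R) (d : Z) :
  tail_summable c -> tail_summable (fun r => c (r + d)%Z).
Proof.
  intros H n. generalize (H (n + d)%Z). apply ex_series_ext.
  intro k. f_equal. lia.
Qed.

Lemma tail_summable_plus (c d : Z -> R) :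
  tail_summable c -> tail_summable d -> tail_summable (fun r => c r + d r)%R.
Proof. intros Hc Hd n. exact (ex_series_plus _ _ (Hc n) (Hd n)). Qed.

Lemma tail_summable_scal (x : R) (c : Z -> R) :
  tail_summable c -> tail_summable (fun r => x * c r)%R.
Proof. intros Hc n. exact (ex_series_scal x _ (Hc n)). Qed.

Lemma tail_summable_le (c d : Z -> R) :
  (forall r, (0 <= d r <= c r)%R) -> tail_summable c -> tail_summable d.
Proof.
  intros H Hc n.
  apply (@ex_series_le R_AbsRing R_CompleteNormedModule _
           (fun k => c (n + Z.of_nat k)%Z)); [|exact (Hc n)].
  intro k. change (Rabs (d (n + Z.of_nat k)%Z) <= c (n + Z.of_nat k)%Z)%R.
  rewrite Rabs_pos_eq; apply H.
Qed.

Lemma ex_series_bounded (u : nat -> R) :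
  ex_series u -> exists B, forall k, (Rabs (u k) <= B)%R.
Proof.
  intro H. apply ex_series_lim_0 in H.
  destruct (filterlim_bounded u (ex_intro _ 0%R H)) as [B HB].
  exists B. exact HB.
Qed.

Lemma tail_step (c : Z -> R) (n : Z) :
  tail_summable c -> tail c n = (c n + tail c (n + 1))%R.
Proof.
  intro H. unfold tail. rewrite (Series_incr_1 _ (H n)). f_equal.
  - f_equal. lia.
  - apply Series_ext. intro k. f_equal. lia.
Qed.

Lemma tail_antitone (c : Z -> R) (n m : Z) :
  (forall r, (0 <= c r)%R) -> tail_summable c -> (n <= m)%Z ->
  (tail c m <= tail c n)%R.
Proof.
  intros Hp Hc L. replace m with (n + Z.of_nat (Z.to_nat (m - n)))%Z by lia.
  induction (Z.to_nat (m - n)) as [|k IH].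
  - replace (n + Z.of_nat 0)%Z with n by lia. lra.
  - rewrite (tail_step c (n + Z.of_nat k) Hc) in IH.
    replace (n + Z.of_nat (S k))%Z with (n + Z.of_nat k + 1)%Z by lia.
    specialize (Hp (n + Z.of_nat k)%Z). lra.
Qed.

Lemma tail_small (c : Z -> R) (eps : R) :
  tail_summable c -> (0 < eps)%R -> exists N, (tail c N < eps)%R.
Proof.
  intros Hc He.
  pose proof (Series_correct _ (Hc 0%Z)) as HS.
  destruct (proj1 (filterlim_locally _ _) HS (mkposreal eps He)) as [N HN].
  specialize (HN N (le_n N)).
  exists (Z.of_nat (S N)). unfold tail.
  rewrite (Series_incr_n (fun k => c (0 + Z.of_nat k)%Z) (S N)) in HN;
    [|lia|apply Hc].
  assert (E : Series (fun k => c (0 + Z.of_nat (S N + k))%Z)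
              = Series (fun k => c (Z.of_nat (S N) + Z.of_nat k)%Z)).
  { apply Series_ext. intro k. f_equal. lia. }
  change (Rabs (sum_n (fun k => c (0 + Z.of_nat k)%Z) N -
     (sum_f_R0 (fun k => c (0 + Z.of_nat k)%Z) N
      + Series (fun k => c (0 + Z.of_nat (S N + k))%Z))) < eps)%R in HN.
  rewrite sum_n_Reals, E in HN. apply Rabs_def2 in HN. lra.
Qed.

(** * The kernel: recursion, boundedness and growth *)

Definition kern_src (a p h X0 X1 X2 X3 : Z -> C) (r : Z) : C :=
  (1 - a r ^ 2) * X0 (r + 1)%Z + h r * X2 r + 2 * p r * (X1 r + X3 r).

(* [kern a p h j n] is K_{n,j-3}, with K_{n,0} = 1 and K_{n,m} = 0 for m < 0,
   so that one recursion covers all m >= 1.  The subtracted term is the limit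
   of K_{r,j-3} as r tends to +oo, which is 1 for j = 3 and 0 otherwise. *)
Fixpoint kern (a p h : Z -> C) (j : nat) : Z -> C :=
  match j with
  | S (S (S (S j0 as j1) as j2) as j3) => fun n =>
      kern a p h j0 (n + 1)%Z - (if Nat.eqb j0 3 then 1 else 0)
      + Csum (fun k => kern_src a p h (kern a p h j0) (kern a p h j1)
                         (kern a p h j2) (kern a p h j3)
                         (n + 1 + Z.of_nat k)%Z)
  | 3%nat => fun _ => 1
  | _ => fun _ => 0
  end.

Definition kern_rhs (a p h : Z -> C) (j : nat) : Z -> C :=
  kern_src a p h (kern a p h j) (kern a p h (1 + j)) (kern a p h (2 + j))
    (kern a p h (3 + j)).

Lemma kern_step (a p h : Z -> C) (j : nat) (n : Z) :
  kern a p h (4 + j) n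
  = kern a p h j (n + 1)%Z - (if Nat.eqb j 3 then 1 else 0)
    + Csum (fun k => kern_rhs a p h j (n + 1 + Z.of_nat k)%Z).
Proof. reflexivity. Qed.

(** A common bound B on the four kernel entries in [kern_src] gives the bound B times this weight;
    the 4 is the factor 2 in front of p_r times the two entries it multiplies. *)
Definition weight (a p h : Z -> C) (r : Z) : R :=
  (Cmod (1 - a r ^ 2) + Cmod (h r) + 4 * Cmod (p r))%R.

Lemma weight_ge0 (a p h : Z -> C) (r : Z) : (0 <= weight a p h r)%R.
Proof.
  unfold weight.
  pose proof (Cmod_ge_0 (1 - a r ^ 2)). pose proof (Cmod_ge_0 (h r)).
  pose proof (Cmod_ge_0 (p r)). lra.
Qed.

Lemma kern_src_bound (a p h X0 X1 X2 X3 : Z -> C) (r : Z) (B : R) :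
  (Cmod (X0 (r + 1)%Z) <= B)%R -> (Cmod (X1 r) <= B)%R ->
  (Cmod (X2 r) <= B)%R -> (Cmod (X3 r) <= B)%R ->
  (Cmod (kern_src a p h X0 X1 X2 X3 r) <= B * weight a p h r)%R.
Proof.
  intros H0 H1 H2 H3. unfold kern_src, weight.
  eapply Rle_trans; [apply Cmod_triangle|].
  eapply Rle_trans; [apply Rplus_le_compat_r, Cmod_triangle|].
  rewrite !Cmod_mult, (Cmod_R 2), (Rabs_pos_eq 2) by lra.
  pose proof (Cmod_triangle (X1 r) (X3 r)) as H13.
  pose proof (Cmod_ge_0 (1 - a r ^ 2)). pose proof (Cmod_ge_0 (h r)).
  pose proof (Cmod_ge_0 (p r)). nra.
Qed.

(** Summability is available only towards +oo here, which leaves the entries uncontrolled at -oo;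
    sums over r >= n only see a right half-line. *)
Definition right_bounded (u : Z -> C) : Prop :=
  forall n, exists B, forall r, (n <= r)%Z -> (Cmod (u r) <= B)%R.

Lemma right_bounded_4 (u0 u1 u2 u3 : Z -> C) (n : Z) :
  right_bounded u0 -> right_bounded u1 -> right_bounded u2 -> right_bounded u3 ->
  exists B, forall r, (n <= r)%Z ->
    (Cmod (u0 r) <= B)%R /\ (Cmod (u1 r) <= B)%R /\
    (Cmod (u2 r) <= B)%R /\ (Cmod (u3 r) <= B)%R.
Proof.
  intros H0 H1 H2 H3.
  destruct (H0 n) as [B0 h0], (H1 n) as [B1 h1], (H2 n) as [B2 h2],
    (H3 n) as [B3 h3].
  exists (Rmax (Rmax B0 B1) (Rmax B2 B3)). intros r L.
  specialize (h0 r L). specialize (h1 r L). specialize (h2 r L).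
  specialize (h3 r L).
  pose proof (Rmax_l (Rmax B0 B1) (Rmax B2 B3)).
  pose proof (Rmax_r (Rmax B0 B1) (Rmax B2 B3)).
  pose proof (Rmax_l B0 B1). pose proof (Rmax_r B0 B1).
  pose proof (Rmax_l B2 B3). pose proof (Rmax_r B2 B3).
  repeat split; lra.
Qed.

Lemma Csum_tail_bound (c : Z -> R) (u : Z -> C) (n : Z) (B : R) :
  tail_summable c ->
  (forall r, (n <= r)%Z -> (Cmod (u r) <= B * c r)%R) ->
  ex_series (fun k => u (n + Z.of_nat k)%Z) /\
  (Cmod (Csum (fun k => u (n + Z.of_nat k)%Z)) <= B * tail c n)%R.
Proof.
  intros Hc Hu.
  assert (Hu' : forall k, (Cmod (u (n + Z.of_nat k)%Z)
                           <= B * c (n + Z.of_nat k)%Z)%R)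
    by (intro k; apply Hu; lia).
  pose proof (tail_summable_scal B c Hc n) as Hb.
  pose proof (ex_series_Cmod_le _ _ Hu' Hb) as He.
  split; [exact He|].
  apply (is_series_Cmod_le _ _ _ _ Hu' (Csum_correct _ He)).
  exact (is_series_scal_l B _ _ (Series_correct _ (Hc n))).
Qed.

(** The recursion reaches back four steps, so the induction carries four consecutive entries. If B
    bounds them, the next one is at most B + 1 + B times the tail of the weight, where the 1 covers
    the limit subtracted at j = 3. *)
Lemma kern_right_bounded_4 (a p h : Z -> C) (j : nat) :
  tail_summable (weight a p h) ->
  right_bounded (kern a p h j) /\ right_bounded (kern a p h (1 + j)) /\
  right_bounded (kern a p h (2 + j)) /\ right_bounded (kern a p h (3 + j)).
Proof.
  intro Hw. induction j as [|j (IH0 & IH1 & IH2 & IH3)].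
  - repeat split; intro n; exists 1%R; intros r _; simpl;
      rewrite ?Cmod_0, ?Cmod_1; lra.
  - repeat split; try assumption. intro n.
    destruct (right_bounded_4 _ _ _ _ n IH0 IH1 IH2 IH3) as [B HB].
    exists (B + 1 + B * tail (weight a p h) n)%R. intros r L.
    change (3 + S j)%nat with (4 + j)%nat. rewrite kern_step.
    destruct (Csum_tail_bound (weight a p h) (kern_rhs a p h j) (r + 1) B Hw)
      as [_ Hs].
    { intros t Ht. destruct (HB t) as (_ & ? & ? & ?); [lia|].
      destruct (HB (t + 1)%Z) as (? & _); [lia|].
      apply kern_src_bound; assumption. }
    pose proof (tail_antitone _ n (r + 1) (weight_ge0 a p h) Hw) as Ha.
    destruct (HB (r + 1)%Z) as (H1 & _); [lia|].
    pose proof (Cmod_ge_0 (kern a p h j (r + 1)%Z)).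
    eapply Rle_trans; [apply Cmod_triangle|].
    apply Rplus_le_compat.
    + unfold Cminus. eapply Rle_trans; [apply Cmod_triangle|].
      rewrite Cmod_opp.
      destruct (Nat.eqb j 3); rewrite ?Cmod_0, ?Cmod_1; lra.
    + eapply Rle_trans; [exact Hs|].
      apply Rmult_le_compat_l; [lra|]. apply Ha. lia.
Qed.

Lemma kern_rhs_summable (a p h : Z -> C) (j : nat) (n : Z) :
  tail_summable (weight a p h) ->
  ex_series (fun k => kern_rhs a p h j (n + Z.of_nat k)%Z).
Proof.
  intro Hw. destruct (kern_right_bounded_4 a p h j Hw) as (H0 & H1 & H2 & H3).
  destruct (right_bounded_4 _ _ _ _ n H0 H1 H2 H3) as [B HB].
  apply (Csum_tail_bound (weight a p h) (kern_rhs a p h j) n B Hw).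
  intros t Ht. destruct (HB t) as (_ & ? & ? & ?); [lia|].
  destruct (HB (t + 1)%Z) as (? & _); [lia|].
  apply kern_src_bound; assumption.
Qed.

(** Subtracting the recursions at n - 1 and n cancels the constant and leaves only the summand r = n
    of the two infinite sums. *)
Lemma kern_diff (a p h : Z -> C) (j : nat) (n : Z) :
  tail_summable (weight a p h) ->
  kern a p h (4 + j) (n - 1)%Z
  = kern a p h (4 + j) n + kern a p h j n - kern a p h j (n + 1)%Z
    + kern_rhs a p h j n.
Proof.
  intro Hw. rewrite !kern_step. replace (n - 1 + 1)%Z with n by lia.
  pose proof (Csum_correct _ (kern_rhs_summable a p h j n Hw)) as H.
  pose proof (Csum_correct _ (kern_rhs_summable a p h j (n + 1) Hw)) as H'.
  assert (E : Csum (fun k => kern_rhs a p h j (n + Z.of_nat k)%Z)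
     = Csum (fun k => kern_rhs a p h j (n + 1 + Z.of_nat k)%Z)
       + kern_rhs a p h j n).
  { apply (is_series_C_unique _ _ _ H).
    apply is_series_decr_1.
    replace (plus _ _)
      with (Csum (fun k => kern_rhs a p h j (n + 1 + Z.of_nat k)%Z)).
    - revert H'. apply is_series_ext. intro k. f_equal. lia.
    - replace (n + Z.of_nat 0)%Z with n by lia.
      change plus with Cplus. change opp with Copp. ring. }
  rewrite E. ring.
Qed.

(** With the tail below rho - 1, entry 4 + j is at most rho^j + rho^(3+j) (rho - 1), and rho^j <=
    rho^(3+j) brings this below rho^(4+j). *)
Lemma kern_growth_right (a p h : Z -> C) (rho : R) :
  tail_summable (weight a p h) -> (1 < rho)%R ->
  exists N, forall j r, (N <= r)%Z -> (Cmod (kern a p h j r) <= rho ^ j)%R.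
Proof.
  intros Hw Hrho.
  destruct (tail_small _ (rho - 1) Hw) as [N HN]; [lra|].
  exists N. intro j.
  enough (H : forall r, (N <= r)%Z ->
    (Cmod (kern a p h j r) <= rho ^ j)%R /\
    (Cmod (kern a p h (1 + j) r) <= rho ^ (1 + j))%R /\
    (Cmod (kern a p h (2 + j) r) <= rho ^ (2 + j))%R /\
    (Cmod (kern a p h (3 + j) r) <= rho ^ (3 + j))%R) by apply H.
  induction j as [|j IH].
  - intros r _. simpl. rewrite !Cmod_0, !Cmod_1. repeat split; nra.
  - intros r L. destruct (IH r L) as (_ & I1 & I2 & I3).
    repeat split; try assumption.
    change (3 + S j)%nat with (4 + j)%nat. rewrite kern_step.
    destruct (Csum_tail_bound (weight a p h) (kern_rhs a p h j) (r + 1)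
                (rho ^ (3 + j)) Hw) as [_ Hs].
    { intros t Ht. destruct (IH t) as (_ & ? & ? & ?); [lia|].
      destruct (IH (t + 1)%Z) as (? & _); [lia|].
      apply kern_src_bound;
        (eapply Rle_trans; [eassumption|apply Rle_pow; [lra|lia]]). }
    pose proof (tail_antitone _ N (r + 1) (weight_ge0 a p h) Hw) as Ha.
    destruct (IH (r + 1)%Z) as (H1 & _); [lia|].
    eapply Rle_trans; [apply Cmod_triangle|].
    apply Rle_trans with (rho ^ j + rho ^ (3 + j) * (rho - 1))%R.
    + apply Rplus_le_compat.
      (* At j = 3 the difference is exactly 1 - 1 = 0; the triangle inequality would leave an extra
         1 that the bound cannot absorb for rho near 1. *)
      * destruct (Nat.eqb_spec j 3) as [->|_].
        -- simpl kern. replace (1 - 1) with (RtoC 0) by ring.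
           rewrite Cmod_0. apply pow_le. lra.
        -- replace (kern a p h j (r + 1) - 0) with (kern a p h j (r + 1)) by ring.
           exact H1.
      * eapply Rle_trans; [exact Hs|]. apply Rmult_le_compat_l.
        -- apply pow_le. lra.
        -- assert (N <= r + 1)%Z by lia. specialize (Ha H). lra.
    + assert (rho ^ j <= rho ^ (3 + j))%R by (apply Rle_pow; [lra|lia]).
      change (rho ^ (4 + j))%R with (rho * rho ^ (3 + j))%R. lra.
Qed.

(** The bound is carried to the left one index at a time. By [kern_diff] an entry at n' - 1 is at
    most three entries at n' or n' + 1 plus a source term, so each step multiplies A by 3 plus the
    weight at n' and keeps rho. *)
Lemma kern_growth (a p h : Z -> C) (rho : R) (n : Z) :
  tail_summable (weight a p h) -> (1 < rho)%R ->
  exists A, forall j r, (n <= r)%Z -> (Cmod (kern a p h j r) <= A * rho ^ j)%R.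
Proof.
  intros Hw Hrho.
  destruct (kern_growth_right a p h rho Hw Hrho) as [N HN].
  assert (H : exists A, (1 <= A)%R /\ forall j r,
    (N - Z.of_nat (Z.to_nat (N - n)) <= r)%Z ->
    (Cmod (kern a p h j r) <= A * rho ^ j)%R).
  { induction (Z.to_nat (N - n)) as [|d [A [HA IH]]].
    - exists 1%R. split; [lra|]. intros j r L. rewrite Rmult_1_l.
      apply HN. lia.
    - set (n' := (N - Z.of_nat d)%Z) in *.
      pose proof (weight_ge0 a p h n') as Hw0.
      assert (HB : (1 <= A * (3 + weight a p h n'))%R) by nra.
      exists (A * (3 + weight a p h n'))%R. split; [exact HB|].
      intros j r L.
      assert (Hp : forall i, (1 <= rho ^ i)%R)
        by (intro i; apply pow_R1_Rle; lra).
      destruct (Z.le_gt_cases n' r) as [L'|L'].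
      { eapply Rle_trans; [exact (IH j r L')|].
        apply Rmult_le_compat_r; [specialize (Hp j); lra|nra]. }
      replace r with (n' - 1)%Z by lia.
      (* The first four entries are the constants 0, 0, 0, 1, outside the reach of [kern_diff]; the
         new constant and the powers of rho are at least 1, which settles them. *)
      destruct j as [|[|[|[|j]]]];
        try (simpl kern; rewrite ?Cmod_0, ?Cmod_1;
             match goal with |- (_ <= _ * rho ^ ?i)%R => specialize (Hp i) end;
             nra).
      change (S (S (S (S j)))) with (4 + j)%nat. rewrite kern_diff by exact Hw.
      assert (I0 := IH j n' (Z.le_refl _)).
      assert (I0' := IH j (n' + 1)%Z ltac:(lia)).
      assert (I1 := IH (1 + j)%nat n' (Z.le_refl _)).
      assert (I2 := IH (2 + j)%nat n' (Z.le_refl _)).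
      assert (I3 := IH (3 + j)%nat n' (Z.le_refl _)).
      assert (I4 := IH (4 + j)%nat n' (Z.le_refl _)).
      set (Q := (A * rho ^ (4 + j))%R) in *.
      assert (E : forall i, (i <= 4 + j)%nat -> (A * rho ^ i <= Q)%R).
      { intros i Hi. apply Rmult_le_compat_l; [lra|].
        apply Rle_pow; [lra|exact Hi]. }
      assert (Hs : (Cmod (kern_rhs a p h j n') <= Q * weight a p h n')%R)
        by (apply kern_src_bound;
            (eapply Rle_trans; [eassumption|apply E; lia])).
      eapply Rle_trans; [apply Cmod_triangle|]. unfold Cminus.
      eapply Rle_trans; [apply Rplus_le_compat_r, Cmod_triangle|].
      rewrite Cmod_opp.
      eapply Rle_trans;
        [apply Rplus_le_compat_r, Rplus_le_compat_r, Cmod_triangle|].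
      assert (A * rho ^ j <= Q)%R by (apply E; lia).
      replace (A * (3 + weight a p h n') * rho ^ (4 + j))%R
        with (Q * 3 + Q * weight a p h n')%R by (unfold Q; ring).
      lra. }
  destruct H as [A [_ HA]]. exists A. intros j r L. apply HA. lia.
Qed.

(** * The generating function of the kernel *)

Lemma is_series_C_ext (u v : nat -> C) (s : C) :
  (forall k, u k = v k) -> is_series u s -> is_series v s.
Proof. exact (is_series_ext u v s). Qed.

Lemma is_series_C_unique_ext (u v : nat -> C) (s t : C) :
  (forall k, u k = v k) -> is_series u s -> is_series v t -> s = t.
Proof.
  intros E Hu. apply is_series_C_unique. exact (is_series_ext _ _ _ E Hu).
Qed.

Lemma is_series_Cplus (u v : nat -> C) (s t : C) :
  is_series u s -> is_series v t -> is_series (fun k => u k + v k) (s + t).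
Proof. exact (@is_series_plus C_AbsRing C_NormedModule u v s t). Qed.

Lemma is_series_Cscal (c : C) (u : nat -> C) (s : C) :
  is_series u s -> is_series (fun k => c * u k) (c * s).
Proof. exact (@is_series_scal C_AbsRing C_NormedModule c u s). Qed.

Lemma is_series_Ctl (u : nat -> C) (s : C) :
  is_series u s -> is_series (fun k => u (S k)) (s - u 0%nat).
Proof.
  intro H. apply is_series_incr_1.
  replace (plus _ _) with s; [exact H|].
  change plus with Cplus. ring.
Qed.

(** As [kern a p h j n] is K_{n,j-3}, this is w^3 times the factor g_n of the ansatz. *)
Definition kern_gf (a p h : Z -> C) (w : C) (n : Z) : C :=
  Csum (fun j => kern a p h j n * w ^ j).

Lemma kern_gf_correct (a p h : Z -> C) (w : C) (n : Z) :
  tail_summable (weight a p h) -> (Cmod w < 1)%R ->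
  is_series (fun j => kern a p h j n * w ^ j) (kern_gf a p h w n).
Proof.
  intros Hw Hlt. apply Csum_correct.
  pose proof (Cmod_ge_0 w) as H0.
  (* The growth rate rho = 2 / (1 + |w|) exceeds 1 and still satisfies rho |w| < 1, because 2 |w| <
     1 + |w|; a geometric series then dominates. *)
  assert (Hr : (1 < 2 / (1 + Cmod w))%R)
    by (apply Rmult_lt_reg_r with (1 + Cmod w)%R; [|field_simplify]; lra).
  destruct (kern_growth a p h _ n Hw Hr) as [A HA].
  set (rho := (2 / (1 + Cmod w))%R) in *.
  apply (ex_series_Cmod_le _ (fun j => A * (rho * Cmod w) ^ j)%R).
  - intro j. rewrite Cmod_mult, Cmod_pow, Rpow_mult_distr, <- Rmult_assoc.
    apply Rmult_le_compat_r; [apply pow_le, H0|]. apply HA. lia.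
  - apply (ex_series_scal_l A (fun j => (rho * Cmod w) ^ j)%R).
    apply ex_series_geom. rewrite Rabs_pos_eq by (apply Rmult_le_pos; lra).
    unfold rho. apply Rmult_lt_reg_r with (1 + Cmod w)%R; [lra|].
    field_simplify; lra.
Qed.

(** The recursion governs the coefficients from index 4 on; the four dropped terms are 0, 0, 0 and
    w^3. *)
Lemma kern_gf_tl (a p h : Z -> C) (w : C) (n : Z) :
  tail_summable (weight a p h) -> (Cmod w < 1)%R ->
  is_series (fun j => kern a p h (4 + j) n * w ^ (4 + j))
    (kern_gf a p h w n - w ^ 3).
Proof.
  intros Hw Hlt. pose proof (kern_gf_correct a p h w n Hw Hlt) as H.
  do 4 apply is_series_Ctl in H. simpl kern in H.
  replace (kern_gf a p h w n - w ^ 3)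
    with (kern_gf a p h w n - 0 * w ^ 0 - 0 * w ^ 1 - 0 * w ^ 2 - 1 * w ^ 3)
    by ring.
  exact H.
Qed.

(** [kern_diff] is multiplied by w^(4+j) and summed over j: the entries of index j, 1 + j, 2 + j, 3
    + j leave the factors w^4, w^3, w^2, w in front of their series. *)
Lemma kern_gf_equation (a p h : Z -> C) (w : C) (n : Z) :
  tail_summable (weight a p h) -> (Cmod w < 1)%R ->
  let g := kern_gf a p h w in
  g (n - 1)%Z = g n + w ^ 4 * (g n - g (n + 1)%Z)
    + (1 - a n ^ 2) * w ^ 4 * g (n + 1)%Z + h n * w ^ 2 * g n
    + 2 * p n * (w ^ 3 + w) * g n.
Proof.
  intros Hw Hlt g.
  pose proof (kern_gf_tl a p h w (n - 1) Hw Hlt) as Hl.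
  pose proof (kern_gf_tl a p h w n Hw Hlt) as H4.
  pose proof (kern_gf_correct a p h w n Hw Hlt) as H0.
  pose proof (kern_gf_correct a p h w (n + 1) Hw Hlt) as H0'.
  pose proof (is_series_Ctl _ _ H0) as H1.
  pose proof (is_series_Ctl _ _ H1) as H2.
  pose proof (is_series_Ctl _ _ H2) as H3.
  cbv beta in H1, H2, H3. fold g in Hl, H4, H0, H0', H1, H2, H3.
  (* The dropped leading coefficients are 0, so the shifted series all still sum to g n. *)
  change (kern a p h 0 n) with (RtoC 0) in H1, H2, H3.
  change (kern a p h 1 n) with (RtoC 0) in H2, H3.
  change (kern a p h 2 n) with (RtoC 0) in H3.
  (* The two contributions of index n + 1, from the difference and from 1 - a_n^2, merge into the
     factor - a_n^2. The w^4 g n comes from the difference alone. *)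
  pose proof (is_series_Cplus _ _ _ _ H4
    (is_series_Cplus _ _ _ _ (is_series_Cscal (w ^ 4) _ _ H0)
    (is_series_Cplus _ _ _ _ (is_series_Cscal (- a n ^ 2 * w ^ 4) _ _ H0')
    (is_series_Cplus _ _ _ _ (is_series_Cscal (h n * w ^ 2) _ _ H2)
    (is_series_Cplus _ _ _ _ (is_series_Cscal (2 * p n * w ^ 3) _ _ H1)
       (is_series_Cscal (2 * p n * w) _ _ H3)))))) as Hr.
  unshelve epose proof (is_series_C_unique_ext _ _ _ _ _ Hl Hr) as E.
  { intro j. cbv beta. rewrite (kern_diff a p h j n Hw). unfold kern_rhs, kern_src.
    rewrite !Cpow_S, Cpow_add_r. simpl Nat.add. ring. }
  assert (E' : g (n - 1)%Z = g (n - 1)%Z - w ^ 3 + w ^ 3) by ring.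
  rewrite E', E. ring.
Qed.

(** * The complex exponential *)

Lemma Cexp_plus (x y : C) : Cexp (x + y) = Cexp x * Cexp y.
Proof.
  unfold Cexp, Cmult, Re, Im; simpl.
  rewrite exp_plus, cos_plus, sin_plus. f_equal; ring.
Qed.

Lemma Cexp_0 : Cexp 0 = 1.
Proof.
  unfold Cexp, RtoC; simpl. rewrite exp_0, cos_0, sin_0. f_equal; ring.
Qed.

Lemma Cexp_opp (x : C) : Cexp x * Cexp (- x) = 1.
Proof. rewrite <- Cexp_plus, <- Cexp_0. f_equal. ring. Qed.

Lemma Cmod_Cexp (x : C) : Cmod (Cexp x) = exp (Re x).
Proof.
  unfold Cmod, Cexp; simpl.
  replace (_ + _)%R
    with (Rsqr (exp (Re x)) * (Rsqr (sin (Im x)) + Rsqr (cos (Im x))))%R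
    by (unfold Rsqr; ring).
  rewrite sin2_cos2, Rmult_1_r. apply sqrt_Rsqr, Rlt_le, exp_pos.
Qed.

Lemma Cexp_nat (x : C) (k : nat) : Cexp (ZtoC (Z.of_nat k) * x) = Cexp x ^ k.
Proof.
  induction k as [|k IH].
  - simpl. rewrite <- Cexp_0. f_equal. unfold ZtoC. simpl. ring.
  - rewrite Cpow_S, <- IH, <- Cexp_plus. f_equal. unfold ZtoC.
    rewrite Nat2Z.inj_succ, succ_IZR, RtoC_plus. ring.
Qed.

Lemma Cexp_half_power (z : C) (k : nat) :
  Cexp (Ci * ZtoC (1 + Z.of_nat k) * z / 2) = Cexp (Ci * (z / 2)) ^ S k.
Proof.
  rewrite <- Cexp_nat. f_equal.
  replace (1 + Z.of_nat k)%Z with (Z.of_nat (S k)) by lia. field.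
Qed.

(** * Limits and infinite products of complex numbers *)

Definition Clim (u : nat -> C) (l : C) : Prop :=
  forall eps : R, (0 < eps)%R ->
  exists N, forall k, (N <= k)%nat -> (Cmod (u k - l) < eps)%R.

Lemma Clim_filterlim (u : nat -> C) (l : C) :
  filterlim u eventually (locally l) <-> Clim u l.
Proof.
  split.
  - intros H eps He.
    exact (proj1 (@filterlim_locally_ball_norm C_AbsRing nat C_NormedModule
                    eventually _ u l) H (mkposreal eps He)).
  - intro H.
    apply (proj2 (@filterlim_locally_ball_norm C_AbsRing nat C_NormedModule
                    eventually _ u l)).
    intros [eps He]. exact (H eps He).
Qed.

Lemma Clim_unique (u : nat -> C) (l l' : C) : Clim u l -> Clim u l' -> l = l'.
Proof.
  intros H H'. apply Clim_filterlim in H, H'.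
  exact (filterlim_locally_unique _ l l' H H').
Qed.

Lemma Clim_ext_from (M : nat) (u v : nat -> C) (l : C) :
  (forall k, (M <= k)%nat -> u k = v k) -> Clim u l -> Clim v l.
Proof.
  intros E H eps He. destruct (H eps He) as [N HN].
  exists (max N M). intros k Hk. rewrite <- E by lia. apply HN. lia.
Qed.

Lemma Clim_comp (phi : nat -> nat) (u : nat -> C) (l : C) :
  (forall M, exists N, forall k, (N <= k)%nat -> (M <= phi k)%nat) ->
  Clim u l -> Clim (fun k => u (phi k)) l.
Proof.
  intros Hphi H eps He. destruct (H eps He) as [M HM].
  destruct (Hphi M) as [N HN]. exists N. intros k Hk. apply HM, HN, Hk.
Qed.

Lemma Clim_scal (c : C) (u : nat -> C) (l : C) :
  Clim u l -> Clim (fun k => c * u k) (c * l).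
Proof.
  intros H eps He.
  pose proof (Cmod_ge_0 c) as Hc.
  destruct (H (eps / (Cmod c + 1))%R) as [N HN].
  { apply Rdiv_lt_0_compat; lra. }
  exists N. intros k Hk. specialize (HN k Hk).
  replace (c * u k - c * l) with (c * (u k - l)) by ring. rewrite Cmod_mult.
  apply (Rmult_lt_compat_l (Cmod c + 1)) in HN; [|lra].
  replace ((Cmod c + 1) * (eps / (Cmod c + 1)))%R with eps in HN
    by (field; lra).
  pose proof (Cmod_ge_0 (u k - l)). lra.
Qed.

(** Each factor satisfies |u| <= 1 + |1 - u| <= exp |1 - u|, so the partial products are bounded by
    the exponential of a bounded sum. *)
Lemma prodZ_bounded (u : Z -> C) (n : Z) :
  ex_series (fun k => Cmod (1 - u (n + Z.of_nat k)%Z)) ->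
  exists B, forall k, (Cmod (prodZ u n k) <= B)%R.
Proof.
  intros [s Hs]. set (d := fun k => Cmod (1 - u (n + Z.of_nat k)%Z)) in Hs.
  destruct (filterlim_bounded (sum_n d) (ex_intro _ s Hs)) as [M HM].
  assert (Hu : forall k, (Cmod (u (n + Z.of_nat k)%Z) <= exp (d k))%R).
  { intro k. apply Rle_trans with (1 + d k)%R; [|apply exp_ineq1_le].
    unfold d. rewrite <- Cmod_1 at 1. rewrite <- (Cmod_opp (1 - _)).
    eapply Rle_trans; [|apply Cmod_triangle]. right. f_equal. ring. }
  assert (H : forall k, (Cmod (prodZ u n (S k)) <= exp (sum_n d k))%R).
  { induction k as [|k IH].
    - rewrite sum_O. simpl prodZ. rewrite Cmult_1_l. exact (Hu 0%nat).
    - rewrite sum_Sn. change plus with Rplus. rewrite exp_plus.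
      change (prodZ u n (S (S k)))
        with (prodZ u n (S k) * u (n + Z.of_nat (S k))%Z).
      rewrite Cmod_mult. apply Rmult_le_compat; auto using Cmod_ge_0. }
  exists (Rmax 1 (exp M)). intros [|k].
  - simpl. rewrite Cmod_1. apply Rmax_l.
  - eapply Rle_trans; [apply H|]. eapply Rle_trans; [|apply Rmax_r].
    specialize (HM k). change (Rabs (sum_n d k) <= M)%R in HM.
    pose proof (Rle_abs (sum_n d k)).
    destruct (Req_dec (sum_n d k) M) as [->|]; [lra|].
    apply Rlt_le, exp_increasing. lra.
Qed.

(** The increments of the partial products are dominated by a multiple of |1 - u|, so they form an
    absolutely convergent series; the limit is its sum plus the empty product 1. *)
Lemma prodZ_cvg (u : Z -> C) (n : Z) :
  ex_series (fun k => Cmod (1 - u (n + Z.of_nat k)%Z)) ->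
  exists P, Clim (prodZ u n) P.
Proof.
  intros Hu. destruct (prodZ_bounded u n Hu) as [B HB].
  set (v := fun k => prodZ u n k * (u (n + Z.of_nat k)%Z - 1)).
  assert (Hv : ex_series v).
  { apply (ex_series_Cmod_le _
             (fun k => B * Cmod (1 - u (n + Z.of_nat k)%Z))%R).
    - intro k. unfold v. rewrite Cmod_mult.
      replace (u (n + Z.of_nat k)%Z - 1) with (- (1 - u (n + Z.of_nat k)%Z))
        by ring.
      rewrite Cmod_opp. apply Rmult_le_compat_r; [apply Cmod_ge_0|apply HB].
    - exact (ex_series_scal_l B _ Hu). }
  destruct Hv as [s Hs].
  exists (s + 1). intros eps He.
  destruct (proj1 (Clim_filterlim _ _) Hs eps He) as [N HN].
  exists (S N). intros [|k] Hk; [lia|].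
  assert (E : forall k, prodZ u n (S k) = sum_n v k + 1).
  { induction k0 as [|k0 IH].
    - rewrite sum_O. unfold v. simpl. ring.
    - rewrite sum_Sn. change plus with Cplus.
      change (prodZ u n (S (S k0)))
        with (prodZ u n (S k0) * u (n + Z.of_nat (S k0))%Z).
      unfold v at 2. rewrite IH. ring. }
  rewrite E. replace (sum_n v k + 1 - (s + 1)) with (sum_n v k - s) by ring.
  apply HN. lia.
Qed.

Lemma prodZ_inv (u v : Z -> C) (n : Z) (k : nat) :
  (forall r, u r * v r = 1) -> prodZ u n k * prodZ v n k = 1.
Proof.
  intro H. induction k as [|k IH]; simpl; [ring|].
  rewrite <- IH. rewrite <- (Cmult_1_r (prodZ u n k * prodZ v n k)).
  rewrite <- (H (n + Z.of_nat k)%Z) at 1. ring.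
Qed.

(** Once |u| >= 1/2 one has |1 - 1/u| <= 2 |1 - u|, so the partial products of the inverses are
    bounded too. Partial products of u tending to 0 would contradict that the two multiply to 1. *)
Lemma prodZ_cvg_neq0 (u : Z -> C) (n : Z) :
  (forall r, u r <> 0) -> tail_summable (fun r => Cmod (1 - u r)) ->
  exists P : C, P <> 0 /\ Clim (prodZ u n) P.
Proof.
  intros Hu Hs. destruct (prodZ_cvg u n (Hs n)) as [P HP].
  exists P. split; [|exact HP]. intros ->.
  assert (Hi : tail_summable (fun r => Cmod (1 - / u r))).
  { destruct (proj1 (is_lim_seq_Reals _ _) (ex_series_lim_0 _ (Hs 0%Z)) (/ 2)%R)
      as [N HN]; [lra|].
    apply (tail_summable_from _ (Z.of_nat N)).
    apply (@ex_series_le R_AbsRing R_CompleteNormedModule _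
             (fun k => 2 * Cmod (1 - u (Z.of_nat N + Z.of_nat k)%Z))%R);
      [|exact (ex_series_scal_l 2%R _ (Hs (Z.of_nat N)))].
    intro k.
    change (Rabs (Cmod (1 - / u (Z.of_nat N + Z.of_nat k)%Z))
            <= 2 * Cmod (1 - u (Z.of_nat N + Z.of_nat k)%Z))%R.
    specialize (HN (N + k)%nat ltac:(lia)).
    replace (0 + Z.of_nat (N + k))%Z with (Z.of_nat N + Z.of_nat k)%Z in HN
      by lia.
    set (x := u (Z.of_nat N + Z.of_nat k)%Z) in *.
    assert (Hx : x <> 0) by apply Hu.
    unfold R_dist in HN. rewrite Rminus_0_r in HN.
    rewrite Rabs_pos_eq in HN |- * by apply Cmod_ge_0.
    replace (1 - / x) with (- (1 - x) * / x) by (field; exact Hx).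
    rewrite Cmod_mult, Cmod_opp, Cmod_inv by exact Hx.
    assert (Hm : (/ 2 <= Cmod x)%R).
    { pose proof (Cmod_triangle (1 - x) x) as Ht.
      replace (1 - x + x) with (RtoC 1) in Ht by ring. rewrite Cmod_1 in Ht.
      lra. }
    pose proof (Cmod_ge_0 (1 - x)).
    rewrite Rmult_comm. apply Rmult_le_compat_r; [lra|].
    rewrite <- (Rinv_inv 2). apply Rinv_le_contravar; lra. }
  destruct (prodZ_bounded (fun r => / u r) n (Hi n)) as [B HB].
  assert (HB0 : (0 <= B)%R)
    by (eapply Rle_trans; [apply Cmod_ge_0|exact (HB 0%nat)]).
  (* Below 1 / (B + 1), a partial product times its inverse product, of modulus at most B, has
     modulus less than 1. *)
  destruct (HP (/ (B + 1))%R) as [N HN]; [apply Rinv_0_lt_compat; lra|].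
  specialize (HN N (le_n N)). specialize (HB N).
  replace (prodZ u n N - 0) with (prodZ u n N) in HN by ring.
  assert (H1 : (Cmod (prodZ u n N) * Cmod (prodZ (fun r => / u r)%C n N) = 1)%R).
  { rewrite <- Cmod_mult, prodZ_inv; [apply Cmod_1|].
    intro r. apply Cinv_r, Hu. }
  pose proof (Cmod_ge_0 (prodZ u n N)).
  apply (Rmult_lt_compat_r (B + 1)) in HN; [|lra].
  rewrite Rinv_l in HN by lra. nra.
Qed.

Lemma prodZ_opp (u : Z -> C) (n : Z) (k : nat) :
  prodZ (fun r => - u r) n k = (- (1)) ^ k * prodZ u n k.
Proof.
  induction k as [|k IH]; simpl; [ring|]. rewrite IH. ring.
Qed.

Lemma sign_parity (i k m : nat) :
  (k + i = 2 * m)%nat -> (- (1)) ^ k = (- (1)) ^ i :> C.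
Proof.
  assert (H : forall j, (- (1)) ^ (2 * j) = 1 :> C).
  { intro j. rewrite Cpow_mult_r. replace ((- (1)) ^ 2) with (RtoC 1) by ring.
    apply Cpow_1_l. }
  intro E. transitivity ((- (1)) ^ (k + i) * (- (1)) ^ i).
  - rewrite Cpow_add_r, <- Cmult_assoc, <- Cpow_add_r.
    replace (i + i)%nat with (2 * i)%nat by lia. rewrite H. ring.
  - rewrite E, H. ring.
Qed.

Lemma is_prod_from_unique (u : Z -> C) (n : Z) (P P' : C) :
  is_prod_from u n P -> is_prod_from u n P' -> P = P'.
Proof. intros [_ H] [_ H']. exact (filterlim_locally_unique _ P P' H H'). Qed.

(** For large N the number of factors, 2N - n, has the parity of n, so the sign is constantly
    (-1)^|n| along these cut-offs. *)
Lemma ex_prod_from_opp (a : Z -> C) (n : Z) :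
  (forall r, a r <> 0) -> tail_summable (fun r => Cmod (1 - a r)) ->
  exists P, is_prod_from (fun r => - a r) n P.
Proof.
  intros Ha Hs. destruct (prodZ_cvg_neq0 a n Ha Hs) as [P [HP HL]].
  exists ((- (1)) ^ Z.abs_nat n * P). split.
  - apply Cmult_neq_0; [|exact HP]. apply Cpow_nz.
    intro E. apply C1_nz. replace (RtoC 1) with (- - (1)) by ring.
    rewrite E. ring.
  - apply Clim_filterlim.
    apply (Clim_ext_from (Z.abs_nat n)
      (fun N => (- (1)) ^ Z.abs_nat n
                * prodZ a n (Z.to_nat (2 * Z.of_nat N - n)))).
    + intros k Hk. rewrite prodZ_opp. f_equal. symmetry.
      (* The witness is half of (2 k - n) + |n|. *)
      apply (sign_parity _ _
               (Z.to_nat (Z.of_nat k - n + Z.max 0 n))). lia.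
    + apply Clim_scal, (Clim_comp (fun N => Z.to_nat (2 * Z.of_nat N - n)));
        [|exact HL].
      intro M. exists (M + Z.abs_nat n)%nat. intros k Hk. lia.
Qed.

Lemma prodZ_S_l (u : Z -> C) (n : Z) (k : nat) :
  prodZ u n (S k) = u n * prodZ u (n + 1) k.
Proof.
  induction k as [|k IH].
  - simpl. replace (n + 0)%Z with n by lia. ring.
  - change (prodZ u n (S (S k)))
      with (prodZ u n (S k) * u (n + Z.of_nat (S k))%Z).
    rewrite IH. simpl prodZ.
    replace (n + 1 + Z.of_nat k)%Z with (n + Z.of_nat (S k))%Z by lia. ring.
Qed.

(** The cut-offs do not depend on n, so for large N the two partial products differ by exactly the
    factor u n. *)
Lemma is_prod_from_step (u : Z -> C) (n : Z) (P P' : C) :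
  is_prod_from u n P -> is_prod_from u (n + 1) P' -> P = u n * P'.
Proof.
  intros [_ H] [_ H']. apply Clim_filterlim in H, H'.
  apply (Clim_unique _ _ _ H).
  apply (Clim_scal (u n)) in H'. revert H'.
  apply (Clim_ext_from (S (Z.abs_nat n))). intros k Hk.
  rewrite <- prodZ_S_l. f_equal. lia.
Qed.

(** * The coefficients and the solution at +oo *)

Lemma weight_summable (a p q : Z -> C) :
  tail_summable (fun r => Cmod (1 - a r)) ->
  tail_summable (fun r => Cmod (p r)) ->
  tail_summable (fun r => Cmod (q r)) ->
  tail_summable (weight a p (hseq a q)).
Proof.
  intros Ha Hp Hq.
  (* 1 - a^2 is (1 + a) (1 - a), and 1 + a = 2 - (1 - a) is bounded because 1 - a is summable. *)
  assert (H1 : tail_summable (fun r => Cmod (1 - a r ^ 2))).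
  { intro n. destruct (ex_series_bounded _ (Ha n)) as [B HB].
    apply (@ex_series_le R_AbsRing R_CompleteNormedModule _
             (fun k => (2 + B) * Cmod (1 - a (n + Z.of_nat k)%Z))%R);
      [|exact (ex_series_scal_l _ _ (Ha n))].
    intro k. specialize (HB k).
    change (Rabs (Cmod (1 - a (n + Z.of_nat k)%Z ^ 2))
            <= (2 + B) * Cmod (1 - a (n + Z.of_nat k)%Z))%R.
    set (x := a (n + Z.of_nat k)%Z) in *.
    rewrite Rabs_pos_eq in HB |- * by apply Cmod_ge_0.
    replace (1 - x ^ 2) with ((2 + - (1 - x)) * (1 - x)) by ring.
    rewrite Cmod_mult. apply Rmult_le_compat_r; [apply Cmod_ge_0|].
    eapply Rle_trans; [apply Cmod_triangle|].
    rewrite Cmod_opp, Cmod_R, Rabs_pos_eq by lra. lra. }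
  assert (H2 : tail_summable (fun r => Cmod (hseq a q r))).
  { pose proof (tail_summable_plus _ _ Ha
      (tail_summable_plus _ _ (tail_summable_shift _ (-1) Ha) Hq)) as H.
    refine (tail_summable_le _ _ _ H). intro r. split; [apply Cmod_ge_0|].
    unfold hseq. replace (r + -1)%Z with (r - 1)%Z by lia.
    replace (2 - a r - a (r - 1)%Z + q r)
      with ((1 - a r) + ((1 - a (r - 1)%Z) + q r)) by ring.
    eapply Rle_trans; [apply Cmod_triangle|].
    apply Rplus_le_compat_l, Cmod_triangle. }
  exact (tail_summable_plus _ _ (tail_summable_plus _ _ H1 H2)
           (tail_summable_scal 4 _ Hp)).
Qed.

Definition jost_coeff (a : Z -> C) (n : Z) : C :=
  / @iota C_CompleteNormedModule (is_prod_from (fun r => - a r) n).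

Lemma jost_coeff_correct (a : Z -> C) (n : Z) :
  (forall r, a r <> 0) -> tail_summable (fun r => Cmod (1 - a r)) ->
  exists P, is_prod_from (fun r => - a r) n P /\ jost_coeff a n = / P.
Proof.
  intros Ha Hs.
  exists (@iota C_CompleteNormedModule (is_prod_from (fun r => - a r) n)).
  split; [|reflexivity].
  destruct (ex_prod_from_opp a n Ha Hs) as [P HP].
  apply (@iota_correct C_AbsRing C_CompleteNormedModule
           (is_prod_from (fun r => - a r) n)).
  exists P. split; [exact HP|]. intros P' HP'.
  exact (is_prod_from_unique _ _ _ _ HP HP').
Qed.

Lemma jost_coeff_neq0 (a : Z -> C) (n : Z) :
  (forall r, a r <> 0) -> tail_summable (fun r => Cmod (1 - a r)) ->
  jost_coeff a n <> 0.
Proof.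
  intros Ha Hs. destruct (jost_coeff_correct a n Ha Hs) as [P [[HP _] ->]].
  intro E. apply C1_nz. rewrite <- (Cinv_r P HP), E. ring.
Qed.

Lemma jost_coeff_step (a : Z -> C) (n : Z) :
  (forall r, a r <> 0) -> tail_summable (fun r => Cmod (1 - a r)) ->
  jost_coeff a (n + 1) = - a n * jost_coeff a n.
Proof.
  intros Ha Hs. destruct (jost_coeff_correct a n Ha Hs) as [P [HP ->]].
  destruct (jost_coeff_correct a (n + 1) Ha Hs) as [P' [HP' ->]].
  rewrite (is_prod_from_step _ _ _ _ HP HP').
  destruct HP' as [H _]. field. auto.
Qed.

Definition jost_kernel (a p h : Z -> C) (n m : Z) : C :=
  kern a p h (Z.to_nat (m + 3)) n.

(** The formulas for K_{n,1} to K_{n,4} are the recursion of [kern] at j = 0, 1, 2, 3 with the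
    constants 0, 0, 0, 1 inserted; at j = 3 the boundary entry 1 cancels the subtracted limit. *)
Lemma jost_kernel_plus (a p q : Z -> C) :
  (forall r, a r <> 0) ->
  tail_summable (fun r => Cmod (1 - a r)) ->
  tail_summable (fun r => Cmod (p r)) ->
  tail_summable (fun r => Cmod (q r)) ->
  kernel_plus a p (hseq a q) (jost_coeff a) (jost_kernel a p (hseq a q)).
Proof.
  intros Ha Hs Hp Hq. pose proof (weight_summable a p q Hs Hp Hq) as Hw.
  set (h := hseq a q) in *. intro n.
  pose proof (fun j => Csum_correct _ (kern_rhs_summable a p h j (n + 1) Hw))
    as HS.
  split; [exact (jost_coeff_correct a n Ha Hs)|].
  split.
  { exists (Csum (fun k => p (n + 1 + Z.of_nat k)%Z)).
    assert (H : is_series (fun k => p (n + 1 + Z.of_nat k)%Z)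
                  (Csum (fun k => p (n + 1 + Z.of_nat k)%Z))).
    { apply Csum_correct.
      exact (ex_series_Cmod_le _ _ (fun k => Rle_refl _) (Hp (n + 1)%Z)). }
    split; [exact H|].
    change (kern a p h (4 + 0) n = 2 * Csum (fun k => p (n + 1 + Z.of_nat k)%Z)).
    unshelve epose proof (is_series_C_unique_ext _ _ _ _ _
                            (is_series_Cscal 2 _ _ H) (HS 0%nat)) as E.
    { intro k. unfold kern_rhs, kern_src. simpl kern. ring. }
    rewrite E, kern_step. simpl kern. simpl Nat.eqb. cbv iota. ring. }
  split; [|split; [|split]].
  - change (jost_kernel a p h n 2) with (kern a p h (4 + 1) n).
    assert (E : kern a p h (4 + 1) n
       = Csum (fun k => kern_rhs a p h 1 (n + 1 + Z.of_nat k)%Z))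
      by (rewrite kern_step; simpl kern at 1; simpl Nat.eqb; cbv iota; ring).
    unfold sum_from. rewrite E.
    generalize (HS 1%nat). apply is_series_C_ext.
    intro k. unfold kern_rhs, kern_src, jost_kernel.
    change (Z.to_nat (1 + 3)) with 4%nat. simpl Nat.add.
    change (kern a p h 1) with (fun _ : Z => RtoC 0).
    change (kern a p h 2) with (fun _ : Z => RtoC 0).
    change (kern a p h 3) with (fun _ : Z => RtoC 1). cbv beta. ring.
  - change (jost_kernel a p h n 3) with (kern a p h (4 + 2) n).
    assert (E : kern a p h (4 + 2) n
       = Csum (fun k => kern_rhs a p h 2 (n + 1 + Z.of_nat k)%Z))
      by (rewrite kern_step; simpl kern at 1; simpl Nat.eqb; cbv iota; ring).
    unfold sum_from. rewrite E.
    generalize (HS 2%nat). apply is_series_C_ext.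
    intro k. unfold kern_rhs, kern_src, jost_kernel.
    change (Z.to_nat (1 + 3)) with 4%nat.
    change (Z.to_nat (2 + 3)) with 5%nat. simpl Nat.add.
    change (kern a p h 2) with (fun _ : Z => RtoC 0).
    change (kern a p h 3) with (fun _ : Z => RtoC 1). cbv beta. ring.
  - change (jost_kernel a p h n 4) with (kern a p h (4 + 3) n).
    assert (E : kern a p h (4 + 3) n
       = Csum (fun k => kern_rhs a p h 3 (n + 1 + Z.of_nat k)%Z))
      by (rewrite kern_step; simpl kern at 1; simpl Nat.eqb; cbv iota; ring).
    unfold sum_from. rewrite E.
    generalize (HS 3%nat). apply is_series_C_ext.
    intro k. unfold kern_rhs, kern_src, jost_kernel.
    change (Z.to_nat (1 + 3)) with 4%nat.
    change (Z.to_nat (2 + 3)) with 5%nat.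
    change (Z.to_nat (3 + 3)) with 6%nat. simpl Nat.add.
    change (kern a p h 3) with (fun _ : Z => RtoC 1). cbv beta. ring.
  - intros m Hm. unfold jost_kernel.
    exists (Csum (fun k => kern_rhs a p h (Z.to_nat (m + 3))
                             (n + 1 + Z.of_nat k)%Z)).
    replace (Z.to_nat (m + 4 + 3)) with (4 + Z.to_nat (m + 3))%nat by lia.
    split.
    + generalize (HS (Z.to_nat (m + 3))). apply is_series_C_ext.
      intro k. unfold kern_rhs, kern_src.
      replace (Z.to_nat (m + 1 + 3)) with (1 + Z.to_nat (m + 3))%nat by lia.
      replace (Z.to_nat (m + 2 + 3)) with (2 + Z.to_nat (m + 3))%nat by lia.
      replace (Z.to_nat (m + 3 + 3)) with (3 + Z.to_nat (m + 3))%nat by lia.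
      reflexivity.
    + rewrite kern_step.
      (* For m >= 1 the index m + 3 exceeds 3, so nothing is subtracted. *)
      destruct (Nat.eqb_spec (Z.to_nat (m + 3)) 3); [lia|]. ring.
Qed.

Lemma jost_plus_solution (a p q : Z -> C) (z : C) :
  (forall r, a r <> 0) ->
  tail_summable (fun r => Cmod (1 - a r)) ->
  tail_summable (fun r => Cmod (p r)) ->
  tail_summable (fun r => Cmod (q r)) ->
  (0 < Im z)%R ->
  exists f,
    jost_plus (jost_coeff a) (jost_kernel a p (hseq a q)) z f /\
    solves a p q (2 * Ccos (z / 2)) f.
Proof.
  intros Ha Hs Hp Hq Hz. pose proof (weight_summable a p q Hs Hp Hq) as Hw.
  set (w := Cexp (Ci * (z / 2))). set (v := Cexp (- (Ci * (z / 2)))).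
  assert (Hwv : w * v = 1) by apply Cexp_opp.
  assert (Hw0 : w <> 0).
  { intro E. rewrite E, Cmult_0_l in Hwv. apply C1_nz. auto. }
  assert (Hlt : (Cmod w < 1)%R).
  { unfold w. rewrite Cmod_Cexp, <- exp_0. apply exp_increasing.
    replace (Re (Ci * (z / 2))) with (- (Im z / 2))%R.
    - lra.
    - destruct z as [x y]. unfold Ci, Cdiv, Cmult, Cinv, RtoC. simpl. field. }
  set (g := kern_gf a p (hseq a q) w).
  set (e := fun n => Cexp (Ci * ZtoC n * z)).
  assert (He : forall n, e (n + 1)%Z = e n * w ^ 2).
  { intro n. unfold e, w. simpl Cpow. rewrite Cmult_1_r, <- !Cexp_plus.
    f_equal. unfold ZtoC. rewrite plus_IZR, RtoC_plus. field. }
  (* Dividing by w^3 undoes the index shift built into [kern_gf]. *)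
  exists (fun n => jost_coeff a n * e n * (g n / w ^ 3)). split.
  - intro n. exists (g n / w ^ 3 - 1). split; [|unfold e; ring].
    pose proof (kern_gf_tl a p (hseq a q) w n Hw Hlt) as H.
    apply (is_series_Cscal (/ w ^ 3)) in H.
    replace (g n / w ^ 3 - 1)
      with (/ w ^ 3 * (kern_gf a p (hseq a q) w n - w ^ 3))
      by (unfold g; field; exact Hw0).
    revert H. apply is_series_C_ext. intro k.
    unfold jost_kernel.
    replace (Z.to_nat (1 + Z.of_nat k + 3)) with (4 + k)%nat by lia.
    rewrite Cexp_half_power. fold w.
    replace (4 + k)%nat with (S k + 3)%nat at 2 by lia.
    rewrite Cpow_add_r. field. exact Hw0.
  - intro n. unfold fdiff.
    replace (n + 1 - 1)%Z with n by lia.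
    replace (n - 1 + 1)%Z with n by lia.
    assert (Hg := kern_gf_equation a p (hseq a q) w n Hw Hlt).
    cbv zeta in Hg. fold g in Hg.
    assert (Ec := jost_coeff_step a n Ha Hs).
    assert (Ec' := jost_coeff_step a (n - 1) Ha Hs).
    assert (Ee := He n). assert (Ee' := He (n - 1)%Z).
    replace (n - 1 + 1)%Z with n in Ec', Ee' by lia.
    (* Only [jost_coeff a (n - 1)], [e (n - 1)], [g n] and [g (n + 1)] remain, and with lambda = w +
       1/w the equation is a rational identity in w. *)
    rewrite Hg, Ec, Ec', Ee, Ee'. unfold hseq.
    replace (2 * Ccos (z / 2)) with (w + v)
      by (unfold Ccos, w, v; field).
    replace v with (/ w).
    + field. exact Hw0.
    + rewrite <- (Cmult_1_r (/ w)), <- Hwv. field. exact Hw0.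
Qed.

(** * Uniqueness from the recursions *)

Lemma kernel_plus_unique (a p h alpha alpha' : Z -> C) (K K' : Z -> Z -> C) :
  kernel_plus a p h alpha K -> kernel_plus a p h alpha' K' ->
  same_plus alpha alpha' K K'.
Proof.
  intros HK HK'.
  assert (H1 : forall n, K' n 1%Z = K n 1%Z).
  { intro n. destruct (HK n) as (_ & (s & Hs & ->) & _).
    destruct (HK' n) as (_ & (s' & Hs' & ->) & _).
    rewrite (is_series_C_unique _ _ _ Hs Hs'). reflexivity. }
  assert (H2 : forall n, K' n 2%Z = K n 2%Z).
  { intro n. destruct (HK n) as (_ & _ & Hs & _).
    destruct (HK' n) as (_ & _ & Hs' & _).
    refine (is_series_C_unique_ext _ _ _ _ _ Hs' Hs). intro k.
    rewrite H1. reflexivity. }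
  assert (H3 : forall n, K' n 3%Z = K n 3%Z).
  { intro n. destruct (HK n) as (_ & _ & _ & Hs & _).
    destruct (HK' n) as (_ & _ & _ & Hs' & _).
    refine (is_series_C_unique_ext _ _ _ _ _ Hs' Hs). intro k.
    rewrite H1, H2. reflexivity. }
  assert (H4 : forall n, K' n 4%Z = K n 4%Z).
  { intro n. destruct (HK n) as (_ & _ & _ & _ & Hs & _).
    destruct (HK' n) as (_ & _ & _ & _ & Hs' & _).
    refine (is_series_C_unique_ext _ _ _ _ _ Hs' Hs). intro k.
    rewrite H1, H2, H3. reflexivity. }
  intro n. split.
  { destruct (HK n) as ((P & HP & ->) & _).
    destruct (HK' n) as ((P' & HP' & ->) & _).
    rewrite (is_prod_from_unique _ _ _ _ HP HP'). reflexivity. }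
  intros m Hm.
  (* The recursion for m + 4 reads the entries m to m + 3, hence the window of four. Its sums run
     over infinitely many r, so the induction on m is for all n at once. *)
  enough (H : forall n,
    K' n m = K n m /\ K' n (m + 1)%Z = K n (m + 1)%Z /\
    K' n (m + 2)%Z = K n (m + 2)%Z /\ K' n (m + 3)%Z = K n (m + 3)%Z) by apply H.
  clear n. revert m Hm.
  refine (Zlt_lower_bound_ind _ 1%Z _). intros m IH Hm n.
  destruct (Z.eq_dec m 1) as [->|Hne]; [auto|].
  assert (Hm1 : (1 <= m - 1 < m)%Z) by lia.
  pose proof (fun r => IH (m - 1)%Z Hm1 r) as IH'.
  replace (m - 1 + 1)%Z with m in IH' by lia.
  replace (m - 1 + 2)%Z with (m + 1)%Z in IH' by lia.
  replace (m - 1 + 3)%Z with (m + 2)%Z in IH' by lia.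
  repeat split; try apply IH'.
  destruct (HK n) as (_ & _ & _ & _ & _ & Hr).
  destruct (HK' n) as (_ & _ & _ & _ & _ & Hr').
  destruct (Hr (m - 1)%Z) as (s & Hs & E); [lia|].
  destruct (Hr' (m - 1)%Z) as (s' & Hs' & E'); [lia|].
  replace (m - 1 + 4)%Z with (m + 3)%Z in E, E' by lia.
  rewrite E, E'. destruct (IH' (n + 1)%Z) as (-> & _). f_equal.
  refine (is_series_C_unique_ext _ _ _ _ _ Hs' Hs). intro k. cbv beta.
  replace (m - 1 + 1)%Z with m by lia.
  replace (m - 1 + 2)%Z with (m + 1)%Z by lia.
  replace (m - 1 + 3)%Z with (m + 2)%Z by lia.
  destruct (IH' (n + 1 + Z.of_nat k)%Z) as (_ & -> & -> & ->).
  destruct (IH' (n + 1 + Z.of_nat k + 1)%Z) as (-> & _). reflexivity.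
Qed.

(** * Uniqueness from the solutions: power series vanishing on (0, 1) *)

Lemma Cseries_terms_bounded (u : nat -> C) :
  ex_series u -> exists B, forall k, (Cmod (u k) <= B)%R.
Proof.
  intros [s Hs].
  destruct (@filterlim_bounded C_AbsRing C_NormedModule (sum_n u)
              (ex_intro _ s Hs)) as [M HM].
  change (forall k, (Cmod (sum_n u k) <= M)%R) in HM.
  assert (HM0 : (0 <= M)%R)
    by (eapply Rle_trans; [apply Cmod_ge_0|exact (HM 0%nat)]).
  exists (M + M)%R. intros [|k].
  - specialize (HM 0%nat). rewrite sum_O in HM. lra.
  - replace (u (S k)) with (sum_n u (S k) + - sum_n u k).
    + eapply Rle_trans; [apply Cmod_triangle|]. rewrite Cmod_opp.
      apply Rplus_le_compat; apply HM.
    + rewrite sum_Sn. change plus with Cplus. ring.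
Qed.

(** Convergence at x = 1/2 yields |c_k| <= M 2^k. For x <= 1/4 the terms after the head then sum to
    at most 2 M x / (1 - 2 x) <= 4 M x, which tends to 0 with x. *)
Lemma Cpseries_zero_head (c : nat -> C) :
  (forall x : R, (0 < x < 1)%R -> is_series (fun k => c k * RtoC x ^ k) (RtoC 0)) ->
  c 0%nat = 0.
Proof.
  intro H.
  destruct (Cseries_terms_bounded _ (ex_intro _ _ (H (/ 2)%R ltac:(lra))))
    as [M HM].
  assert (HM0 : (0 <= M)%R)
    by (eapply Rle_trans; [apply Cmod_ge_0|exact (HM 0%nat)]).
  assert (Hc : forall k, (Cmod (c k) <= M * 2 ^ k)%R).
  { intro k. specialize (HM k).
    rewrite Cmod_mult, Cmod_pow, Cmod_R, Rabs_pos_eq, pow_inv in HM by lra.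
    apply (Rmult_le_compat_r (2 ^ k)) in HM; [|apply pow_le; lra].
    rewrite Rmult_assoc, Rinv_l, Rmult_1_r in HM; [exact HM|].
    apply pow_nonzero. lra. }
  assert (Hx : forall x, (0 < x <= / 4)%R -> (Cmod (c 0%nat) <= 4 * M * x)%R).
  { intros x Hx. assert (H01 : (0 < x < 1)%R) by lra.
    pose proof (is_series_Ctl _ _ (H x H01)) as Ht. cbv beta in Ht.
    replace (0 - c 0%nat * RtoC x ^ 0) with (- c 0%nat) in Ht by (simpl; ring).
    rewrite <- Cmod_opp.
    apply Rle_trans with (2 * M * x * / (1 - 2 * x))%R.
    - refine (is_series_Cmod_le _ (fun k => 2 * M * x * (2 * x) ^ k)%R
                _ _ _ Ht _).
      + intro k. rewrite Cmod_mult, Cmod_pow, Cmod_R, Rabs_pos_eq by lra.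
        specialize (Hc (S k)). rewrite Rpow_mult_distr. simpl in Hc |- *.
        replace (2 * M * x * (2 ^ k * x ^ k))%R
          with (M * (2 * 2 ^ k) * (x * x ^ k))%R by ring.
        apply Rmult_le_compat_r; [|exact Hc].
        apply Rmult_le_pos; [lra|apply pow_le; lra].
      + assert (Hg : is_series (fun k => (2 * x) ^ k)%R (/ (1 - 2 * x))%R)
          by (apply is_series_geom; rewrite Rabs_pos_eq; lra).
        exact (is_series_scal_l (2 * M * x)%R _ _ Hg).
    - apply Rmult_le_reg_r with (1 - 2 * x)%R; [lra|].
      replace (2 * M * x * / (1 - 2 * x) * (1 - 2 * x))%R with (2 * M * x)%R
        by (field; lra).
      assert (0 <= M * x)%R by (apply Rmult_le_pos; lra). nra. }
  apply Cmod_eq_0. apply Rle_antisym; [|apply Cmod_ge_0].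
  apply Rnot_lt_le. intro Hpos.
  set (e := Cmod (c 0%nat)) in *.
  assert (Hd : (0 < 4 * e + 8 * (M + 1))%R) by lra.
  (* The summand 4 e in the denominator ensures x <= 1/4, and 8 (M + 1) ensures 4 M x < e. *)
  set (x := (e / (4 * e + 8 * (M + 1)))%R).
  assert (Ex : (x * (4 * e + 8 * (M + 1)) = e)%R) by (unfold x; field; lra).
  assert (Hx0 : (0 < x)%R) by (apply Rdiv_lt_0_compat; lra).
  assert (Hx4 : (x <= / 4)%R) by nra.
  specialize (Hx x (conj Hx0 Hx4)). nra.
Qed.

(** Once the head vanishes, division by x gives the same property for the shifted sequence, and
    induction reaches every coefficient. *)
Lemma Cpseries_zero (c : nat -> C) :
  (forall x : R, (0 < x < 1)%R -> is_series (fun k => c k * RtoC x ^ k) (RtoC 0)) ->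
  forall k, c k = 0.
Proof.
  intros H k. revert c H. induction k as [|k IH]; intros c H.
  - exact (Cpseries_zero_head c H).
  - apply (IH (fun i => c (S i))). intros x Hx.
    pose proof (is_series_Cscal (/ RtoC x) _ _ (is_series_Ctl _ _ (H x Hx)))
      as Hs.
    cbv beta in Hs. rewrite (Cpseries_zero_head c H) in Hs.
    replace (/ RtoC x * (0 - 0 * RtoC x ^ 0)) with (RtoC 0) in Hs by ring.
    revert Hs. apply is_series_C_ext. intro i. rewrite Cpow_S.
    field. intro E. apply RtoC_inj in E. lra.
Qed.

Lemma is_series_Ccons (u : nat -> C) (s : C) :
  is_series (fun k => u (S k)) s -> is_series u (u 0%nat + s).
Proof.
  intro H. apply is_series_decr_1.
  replace (plus _ _) with s; [exact H|].
  change plus with Cplus. change opp with Copp. ring.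
Qed.

(** On the imaginary axis the variable w = e^{iz/2} is real; for x in (0, 1) the point z = - 2 i ln
    x lies in the upper half-plane and has w = x. *)
Lemma Cexp_log_half (x : R) :
  (0 < x)%R -> Cexp (Ci * ((0, -2 * ln x)%R / 2)) = RtoC x.
Proof.
  intro Hx. replace (Ci * ((0, -2 * ln x)%R / 2)) with (RtoC (ln x)).
  - unfold Cexp, RtoC, Re, Im; simpl. rewrite exp_ln, cos_0, sin_0 by exact Hx.
    f_equal; ring.
  - unfold Ci, RtoC, Cdiv, Cmult, Cinv; simpl. f_equal; field.
Qed.

(** Subtracting two representations of one f and dividing by e^{inz} leaves a power series in w,
    with coefficients [c], that vanishes on (0, 1). Its head gives alpha' = alpha; since alpha is
    nonzero, the other coefficients give K' = K. *)
Lemma jost_plus_unique (alpha alpha' : Z -> C) (K K' : Z -> Z -> C) :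
  (forall n, alpha n <> 0) ->
  (forall z : C, (0 < Im z)%R ->
     exists f, jost_plus alpha K z f /\ jost_plus alpha' K' z f) ->
  same_plus alpha alpha' K K'.
Proof.
  intros Ha H n.
  set (c := fun k => match k with
    | O => alpha n - alpha' n
    | S i => alpha n * K n (1 + Z.of_nat i)%Z
             - alpha' n * K' n (1 + Z.of_nat i)%Z
    end).
  assert (Hc : forall k, c k = 0).
  { apply Cpseries_zero. intros x Hx.
    set (z := (0, -2 * ln x)%R : C).
    assert (Hz : (0 < Im z)%R).
    { unfold z. simpl. assert (ln x < ln 1)%R by (apply ln_increasing; lra).
      rewrite ln_1 in *. lra. }
    destruct (H z Hz) as (f & Hf & Hf').
    destruct (Hf n) as (s & Hs & E). destruct (Hf' n) as (s' & Hs' & E').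
    assert (E0 : alpha n - alpha' n + (alpha n * s + - alpha' n * s') = 0).
    { set (e := Cexp (Ci * ZtoC n * z)) in *.
      assert (He : e <> 0).
      { intro E0. apply C1_nz. rewrite <- (Cexp_opp (Ci * ZtoC n * z)).
        fold e. rewrite E0. ring. }
      replace (alpha n - alpha' n + (alpha n * s + - alpha' n * s'))
        with (/ e * (alpha n * e * (1 + s) - alpha' n * e * (1 + s')))
        by (field; exact He).
      rewrite <- E, <- E'. ring. }
    rewrite <- E0.
    replace (alpha n - alpha' n) with (c 0%nat * RtoC x ^ 0) by (simpl; ring).
    apply is_series_Ccons.
    generalize (is_series_Cplus _ _ _ _ (is_series_Cscal (alpha n) _ _ Hs)
                  (is_series_Cscal (- alpha' n) _ _ Hs')).
    apply is_series_C_ext. intro k. cbv beta.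
    rewrite Cexp_half_power. unfold z. rewrite Cexp_log_half by lra.
    unfold c. ring. }
  assert (E : alpha' n = alpha n).
  { pose proof (Hc 0%nat) as H0. unfold c in H0.
    replace (alpha n) with (alpha n - alpha' n + alpha' n) by ring.
    rewrite H0. ring. }
  split; [exact E|]. intros m Hm.
  pose proof (Hc (S (Z.to_nat (m - 1)))) as H1. unfold c in H1.
  replace (1 + Z.of_nat (Z.to_nat (m - 1)))%Z with m in H1 by lia.
  rewrite E in H1.
  replace (K' n m)
    with (K n m - / alpha n * (alpha n * K n m - alpha n * K' n m))
    by (field; apply Ha).
  rewrite H1. ring.
Qed.

(** Summability is assumed towards +oo only, so that the reflected sequences, controlled by the sums
    towards -oo, fit as well. *)
Lemma theorem_plus (a p q : Z -> C) :
  (forall n, a n <> 0) ->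
  tail_summable (fun r => Cmod (1 - a r)) ->
  tail_summable (fun r => Cmod (p r)) ->
  tail_summable (fun r => Cmod (q r)) ->
  exists (alpha : Z -> C) (K : Z -> Z -> C),
    kernel_plus a p (hseq a q) alpha K /\
    (forall alpha' K', kernel_plus a p (hseq a q) alpha' K' ->
       same_plus alpha alpha' K K') /\
    (forall z : C, (0 < Im z)%R ->
       exists f, jost_plus alpha K z f /\ solves a p q (2 * Ccos (z / 2)) f) /\
    (forall alpha' K',
       (forall z : C, (0 < Im z)%R ->
          exists f, jost_plus alpha K z f /\ jost_plus alpha' K' z f) ->
       same_plus alpha alpha' K K').
Proof.
  intros Ha Hs Hp Hq.
  exists (jost_coeff a), (jost_kernel a p (hseq a q)).
  pose proof (jost_kernel_plus a p q Ha Hs Hp Hq) as HK.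
  split; [exact HK|]. split; [|split].
  - intros alpha' K'. exact (kernel_plus_unique _ _ _ _ _ _ _ HK).
  - intro z. exact (jost_plus_solution a p q z Ha Hs Hp Hq).
  - intros alpha' K'. apply jost_plus_unique.
    intro n. exact (jost_coeff_neq0 a n Ha Hs).
Qed.

(** * Reflection and the statement at -oo *)

Lemma sum_upto_reflect (u v : Z -> C) (n n' : Z) (s : C) :
  n' = (- n)%Z -> (forall r, v r = u (- r)%Z) ->
  sum_upto u n' s <-> sum_from v n s.
Proof.
  intros -> E. unfold sum_upto, sum_from.
  split; apply is_series_C_ext; intro k; rewrite E; f_equal; lia.
Qed.

(** Reflection reverses the order of the factors, so the first factor on one side is matched with
    the last on the other. *)
Lemma prodZ_reflect (u v : Z -> C) (n : Z) (k : nat) :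
  (forall r, v r = u (- r - 1)%Z) ->
  prodZ u (- n - Z.of_nat k) k = prodZ v n k.
Proof.
  intro E. induction k as [|k IH]; [reflexivity|].
  rewrite prodZ_S_l. simpl prodZ. rewrite <- IH, E, Cmult_comm.
  f_equal; f_equal; lia.
Qed.

(** The cut-offs correspond exactly: r >= - 2N turns into - r - 1 < 2N, and no sign enters. *)
Lemma is_prod_upto_reflect (u v : Z -> C) (n : Z) (P : C) :
  (forall r, v r = u (- r - 1)%Z) ->
  is_prod_upto u (- n - 1) P <-> is_prod_from v n P.
Proof.
  intro E. unfold is_prod_upto, is_prod_from.
  assert (H : forall N : nat,
    prodZ u (- (2 * Z.of_nat N))
      (Z.to_nat (- n - 1 + 1 + 2 * Z.of_nat N))
    = prodZ v n (Z.to_nat (2 * Z.of_nat N - n))).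
  { intro N. rewrite <- (prodZ_reflect u v) by exact E.
    replace (- n - 1 + 1 + 2 * Z.of_nat N)%Z with (2 * Z.of_nat N - n)%Z by lia.
    (* For 2N <= n both products are empty, whatever their starting points. *)
    destruct (Z.le_gt_cases (2 * Z.of_nat N) n).
    - replace (Z.to_nat (2 * Z.of_nat N - n)) with 0%nat by lia. reflexivity.
    - f_equal. lia. }
  split; intros [HP HL]; (split; [exact HP|]); revert HL;
    apply filterlim_ext; intro N; [|symmetry]; apply H.
Qed.

(** In the difference equation a_r couples the sites r and r + 1. Reflecting the sites sends this
    edge to the one between - r - 1 and - r, hence the index - r - 1 for a and - r for the sequences
    living on sites. *)
Lemma kernel_reflect (a p h a' p' h' alpha alpha' : Z -> C)
    (K K' : Z -> Z -> C) :
  (forall r, a' r = a (- r - 1)%Z) -> (forall r, p' r = p (- r)%Z) ->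
  (forall r, h' r = h (- r)%Z) -> (forall r, alpha' r = alpha (- r)%Z) ->
  (forall r m, K' r m = K (- r)%Z (- m)%Z) ->
  kernel_minus a p h alpha K <-> kernel_plus a' p' h' alpha' K'.
Proof.
  intros Ea Ep Eh Eal EK.
  (* Both predicates quantify over all n, so it suffices to match the clauses at - n with those at
     n. *)
  assert (Hrefl : forall A B : Z -> Prop,
    (forall n, A (- n)%Z <-> B n) -> (forall n, A n) <-> (forall n, B n)).
  { intros A B H. split; intros HA n; [apply H, HA|].
    rewrite <- (Z.opp_involutive n). apply H, HA. }
  apply Hrefl. intro n.
  assert (Hidx : (- n - 1 = - (n + 1))%Z) by lia.
  repeat apply Morphisms_Prop.and_iff_morphism.
  - assert (H : forall P, is_prod_upto (fun r => - a r) (- n - 1) P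
                          <-> is_prod_from (fun r => - a' r) n P).
    { intro P. apply is_prod_upto_reflect. intro r. rewrite Ea. reflexivity. }
    rewrite Eal.
    split; intros [P [HP E]]; exists P; (split; [apply H, HP|exact E]).
  - rewrite EK.
    split; intros [s [Hs E]]; exists s;
      (split; [apply (sum_upto_reflect _ _ _ _ _ Hidx Ep), Hs|exact E]).
  - rewrite EK. apply sum_upto_reflect; [exact Hidx|]. intro r.
    rewrite Eh, Ep, EK. reflexivity.
  - rewrite EK. apply sum_upto_reflect; [exact Hidx|]. intro r.
    rewrite Eh, Ep, !EK. reflexivity.
  - rewrite EK. apply sum_upto_reflect; [exact Hidx|]. intro r.
    rewrite Ea, Eh, Ep, !EK. reflexivity.
  - assert (H : forall m s,
      sum_upto (fun r => (1 - a (r - 1)%Z ^ 2) * K (r - 1)%Z (- m)%Z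
                         + h r * K r (- m - 2)%Z
                         + 2 * p r * (K r (- m - 1)%Z + K r (- m - 3)%Z))
        (- n - 1) s
      <-> sum_from (fun r => (1 - a' r ^ 2) * K' (r + 1)%Z m
                             + h' r * K' r (m + 2)%Z
                             + 2 * p' r * (K' r (m + 1)%Z + K' r (m + 3)%Z))
            (n + 1) s).
    { intros m s. apply sum_upto_reflect; [exact Hidx|]. intro r.
      rewrite Ea, Eh, Ep, !EK.
      replace (- (r + 1))%Z with (- r - 1)%Z by lia.
      replace (- (m + 1))%Z with (- m - 1)%Z by lia.
      replace (- (m + 2))%Z with (- m - 2)%Z by lia.
      replace (- (m + 3))%Z with (- m - 3)%Z by lia. reflexivity. }
    split; intros HA m Hm.
    + destruct (HA (- m)%Z) as [s [Hs E]]; [lia|].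
      exists s. split; [exact (proj1 (H m s) Hs)|].
      rewrite !EK.
      replace (- (m + 4))%Z with (- m - 4)%Z by lia.
      replace (- (n + 1))%Z with (- n - 1)%Z by lia. exact E.
    + destruct (HA (- m)%Z) as [s [Hs E]]; [lia|].
      apply H in Hs. rewrite !EK in E. rewrite !Z.opp_involutive in *.
      exists s. split; [exact Hs|].
      replace (m - 4)%Z with (- (- m + 4))%Z by lia.
      replace (- n - 1)%Z with (- (n + 1))%Z by lia. exact E.
Qed.

Lemma jost_reflect (alpha alpha' f f' : Z -> C) (K K' : Z -> Z -> C) (z : C) :
  (forall r, alpha' r = alpha (- r)%Z) -> (forall r, f' r = f (- r)%Z) ->
  (forall r m, K' r m = K (- r)%Z (- m)%Z) ->
  jost_minus alpha K z f <-> jost_plus alpha' K' z f'.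
Proof.
  intros Eal Ef EK.
  assert (H : forall n s,
    sum_upto (fun m => K (- n)%Z m * Cexp (- (Ci * ZtoC m * z / 2))) (-1) s
    <-> sum_from (fun m => K' n m * Cexp (Ci * ZtoC m * z / 2)) 1 s).
  { intros n s. apply sum_upto_reflect; [reflexivity|]. intro r.
    rewrite EK. do 2 f_equal. unfold ZtoC. rewrite opp_IZR, RtoC_opp. field. }
  assert (He : forall n, - (Ci * ZtoC (- n) * z) = Ci * ZtoC n * z).
  { intro n. unfold ZtoC. rewrite opp_IZR, RtoC_opp. ring. }
  split; intros HJ n.
  - destruct (HJ (- n)%Z) as [s [Hs E]]. exists s.
    split; [exact (proj1 (H n s) Hs)|].
    rewrite Ef, Eal, E, He. reflexivity.
  - destruct (HJ (- n)%Z) as [s [Hs E]]. apply H in Hs.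
    rewrite Ef, Eal, <- He, !Z.opp_involutive in E.
    rewrite !Z.opp_involutive in Hs. exists s. auto.
Qed.

Lemma solves_reflect (a p q a' p' q' f f' : Z -> C) (lambda : C) :
  (forall r, a' r = a (- r - 1)%Z) -> (forall r, p' r = p (- r)%Z) ->
  (forall r, q' r = q (- r)%Z) -> (forall r, f' r = f (- r)%Z) ->
  solves a' p' q' lambda f' -> solves a p q lambda f.
Proof.
  intros Ea Ep Eq Ef H n. specialize (H (- n)%Z). revert H.
  unfold fdiff. rewrite !Ea, Ep, Eq, !Ef.
  replace (- (- n + 1 - 1) - 1)%Z with (n - 1)%Z by lia.
  replace (- (- n - 1) - 1)%Z with n by lia.
  replace (- (- n + 1 - 1 + 1))%Z with (n - 1)%Z by lia.
  replace (- (- n + 1 - 1))%Z with n by lia.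
  replace (- (- n - 1 + 1))%Z with n by lia.
  replace (- (- n - 1))%Z with (n + 1)%Z by lia.
  replace (n + 1 - 1)%Z with n by lia.
  replace (n - 1 + 1)%Z with n by lia.
  rewrite Z.opp_involutive. intros <-. ring.
Qed.

(** h_n is symmetric in a_n and a_{n-1}, which the reflection interchanges. *)
Lemma hseq_reflect (a q : Z -> C) (r : Z) :
  hseq (fun n => a (- n - 1)%Z) (fun n => q (- n)%Z) r = hseq a q (- r)%Z.
Proof.
  unfold hseq. replace (- (r - 1) - 1)%Z with (- r)%Z by lia. ring.
Qed.

Lemma same_reflect (alpha alpha' beta beta' : Z -> C)
    (K K' L L' : Z -> Z -> C) :
  (forall r, beta r = alpha (- r)%Z) -> (forall r, beta' r = alpha' (- r)%Z) ->
  (forall r m, L r m = K (- r)%Z (- m)%Z) ->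
  (forall r m, L' r m = K' (- r)%Z (- m)%Z) ->
  same_plus beta beta' L L' -> same_minus alpha alpha' K K'.
Proof.
  intros Eb Eb' EL EL' H n. destruct (H (- n)%Z) as [Ha HK]. split.
  - rewrite Eb, Eb', !Z.opp_involutive in Ha. exact Ha.
  - intros m Hm. specialize (HK (- m)%Z ltac:(lia)).
    rewrite EL, EL', !Z.opp_involutive in HK. exact HK.
Qed.

Lemma theorem_minus (a p q : Z -> C) :
  (forall n, a n <> 0) ->
  tail_summable (fun r => Cmod (1 - a (- r - 1)%Z)) ->
  tail_summable (fun r => Cmod (p (- r)%Z)) ->
  tail_summable (fun r => Cmod (q (- r)%Z)) ->
  exists (alpha : Z -> C) (K : Z -> Z -> C),
    kernel_minus a p (hseq a q) alpha K /\
    (forall alpha' K', kernel_minus a p (hseq a q) alpha' K' ->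
       same_minus alpha alpha' K K') /\
    (forall z : C, (0 < Im z)%R ->
       exists f, jost_minus alpha K z f /\ solves a p q (2 * Ccos (z / 2)) f) /\
    (forall alpha' K',
       (forall z : C, (0 < Im z)%R ->
          exists f, jost_minus alpha K z f /\ jost_minus alpha' K' z f) ->
       same_minus alpha alpha' K K').
Proof.
  intros Ha Hs Hp Hq.
  destruct (theorem_plus (fun r => a (- r - 1)%Z) (fun r => p (- r)%Z)
              (fun r => q (- r)%Z) (fun r => Ha _) Hs Hp Hq)
    as (alpha & K & HK & HKu & HJ & HJu).
  (* Reflecting twice is the identity, so the data at +oo are in turn the reflection of those
     constructed at -oo. *)
  assert (Ei : forall u : Z -> C, forall r, u r = u (- - r)%Z)
    by (intros u r; rewrite Z.opp_involutive; reflexivity).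
  assert (EK : forall r m, K r m = K (- - r)%Z (- - m)%Z)
    by (intros r m; rewrite !Z.opp_involutive; reflexivity).
  exists (fun r => alpha (- r)%Z), (fun r m => K (- r)%Z (- m)%Z).
  split; [|split; [|split]].
  - refine (proj2 (kernel_reflect _ _ _ _ _ _ _ _ _ _ _ _ _ _ _) HK);
      auto using hseq_reflect.
  - intros alpha' K' HK'.
    apply (same_reflect _ _ alpha (fun r => alpha' (- r)%Z)
             _ _ K (fun r m => K' (- r)%Z (- m)%Z)); auto.
    apply HKu.
    refine (proj1 (kernel_reflect _ _ _ _ _ _ _ _ _ _ _ _ _ _ _) HK');
      auto using hseq_reflect.
  - intros z Hz. destruct (HJ z Hz) as (f & Hf & Hsol).
    exists (fun r => f (- r)%Z). split.
    + refine (proj2 (jost_reflect _ _ _ _ _ _ z _ _ _) Hf); auto.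
    + refine (solves_reflect _ _ _ _ _ _ _ _ _ _ _ _ _ Hsol); auto.
  - intros alpha' K' H.
    apply (same_reflect _ _ alpha (fun r => alpha' (- r)%Z)
             _ _ K (fun r m => K' (- r)%Z (- m)%Z)); auto.
    apply HJu. intros z Hz. destruct (H z Hz) as (f & Hf & Hf').
    exists (fun r => f (- r)%Z). split.
    + refine (proj1 (jost_reflect _ _ _ _ _ _ z _ _ _) Hf); auto.
    + refine (proj1 (jost_reflect _ _ _ _ _ _ z _ _ _) Hf'); auto.
Qed.

(** * From the weighted sum over Z to one-sided sums *)

Lemma half_line_summable (c : nat -> R) (w : nat -> R) :
  (forall k, (0 <= c k)%R) -> (forall k, (1 <= w k)%R) ->
  ex_series (fun k => w k * c k)%R -> ex_series c.
Proof.
  intros Hc Hw. apply (@ex_series_le R_AbsRing R_CompleteNormedModule).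
  intro k. change (Rabs (c k) <= w k * c k)%R.
  specialize (Hc k). specialize (Hw k). rewrite Rabs_pos_eq by lra. nra.
Qed.

Lemma ex_series_Cmod_summands (u v w : nat -> C) :
  ex_series (fun k => Cmod (u k) + Cmod (v k) + Cmod (w k))%R ->
  ex_series (fun k => Cmod (u k)) /\ ex_series (fun k => Cmod (v k)) /\
  ex_series (fun k => Cmod (w k)).
Proof.
  intro H.
  repeat split; revert H; apply (@ex_series_le R_AbsRing R_CompleteNormedModule);
    intro k; pose proof (Cmod_ge_0 (u k)); pose proof (Cmod_ge_0 (v k));
    pose proof (Cmod_ge_0 (w k)).
  - change (Rabs (Cmod (u k)) <= Cmod (u k) + Cmod (v k) + Cmod (w k))%R.
    rewrite Rabs_pos_eq; lra.
  - change (Rabs (Cmod (v k)) <= Cmod (u k) + Cmod (v k) + Cmod (w k))%R.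
    rewrite Rabs_pos_eq; lra.
  - change (Rabs (Cmod (w k)) <= Cmod (u k) + Cmod (v k) + Cmod (w k))%R.
    rewrite Rabs_pos_eq; lra.
Qed.

Theorem theorem1 (a p q : Z -> C)
  (ha : forall n : Z, a n <> RtoC 0)
  (hsum : summableZ (fun n : Z =>
     (Rabs (IZR n) * (Cmod (RtoC 1 - a n)%C + Cmod (p n) + Cmod (q n)))%R)) :
  (exists (alpha : Z -> C) (K : Z -> Z -> C),
     kernel_plus a p (hseq a q) alpha K /\
     (forall (alpha' : Z -> C) (K' : Z -> Z -> C),
        kernel_plus a p (hseq a q) alpha' K' ->
        same_plus alpha alpha' K K') /\
     (forall z : C, (0 < Im z)%R ->
        exists f : Z -> C,
          jost_plus alpha K z f /\
          solves a p q (RtoC 2 * Ccos (z / RtoC 2))%C f) /\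
     (forall (alpha' : Z -> C) (K' : Z -> Z -> C),
        (forall z : C, (0 < Im z)%R ->
           exists f : Z -> C,
             jost_plus alpha K z f /\ jost_plus alpha' K' z f) ->
        same_plus alpha alpha' K K')) /\
  (exists (alpha : Z -> C) (K : Z -> Z -> C),
     kernel_minus a p (hseq a q) alpha K /\
     (forall (alpha' : Z -> C) (K' : Z -> Z -> C),
        kernel_minus a p (hseq a q) alpha' K' ->
        same_minus alpha alpha' K K') /\
     (forall z : C, (0 < Im z)%R ->
        exists f : Z -> C,
          jost_minus alpha K z f /\
          solves a p q (RtoC 2 * Ccos (z / RtoC 2))%C f) /\
     (forall (alpha' : Z -> C) (K' : Z -> Z -> C),
        (forall z : C, (0 < Im z)%R ->
           exists f : Z -> C,
             jost_minus alpha K z f /\ jost_minus alpha' K' z f) ->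
        same_minus alpha alpha' K K')).

Proof.
  destruct hsum as [Hr Hl].
  (* The weight |n| vanishes at n = 0, so that term is dropped before comparing with weights at
     least 1; the left half already starts at -1. *)
  apply (ex_series_incr_n _ 1) in Hr.
  apply half_line_summable in Hr, Hl.
  - apply ex_series_Cmod_summands in Hr as (Ra & Rp & Rq), Hl as (La & Lp & Lq).
    split.
    + apply theorem_plus; [exact ha| | |];
        apply (tail_summable_from _ 1%Z).
      * revert Ra. apply ex_series_ext. intro k. do 3 f_equal. lia.
      * revert Rp. apply ex_series_ext. intro k. do 2 f_equal. lia.
      * revert Rq. apply ex_series_ext. intro k. do 2 f_equal. lia.
    + apply theorem_minus; [exact ha| | |].
      (* The reflected a_{-r-1} meets the index -1 at r = 0, whereas p_{-r} and q_{-r} meet it at r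
         = 1. *)
      * apply (tail_summable_from _ 0%Z).
        revert La. apply ex_series_ext. intro k. do 3 f_equal. lia.
      * apply (tail_summable_from _ 1%Z).
        revert Lp. apply ex_series_ext. intro k. do 2 f_equal. lia.
      * apply (tail_summable_from _ 1%Z).
        revert Lq. apply ex_series_ext. intro k. do 2 f_equal. lia.
  - intro k. repeat apply Rplus_le_le_0_compat; apply Cmod_ge_0.
  - intro k. rewrite <- abs_IZR. apply IZR_le. lia.
  - intro k. repeat apply Rplus_le_le_0_compat; apply Cmod_ge_0.
  - intro k. rewrite <- abs_IZR. apply IZR_le. lia.
Qed.
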